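(* Let $n\ge2$, let the Hamiltonian $(H_0,H_1)$ be ideal and let $\rho_d$ be a generic stationary target state ($[H_0,\rho_d]=0$). Then all the $n!$ stationary states $\rho^{(k)}$ (with Bloch vectors $\vec s^{(k)}$), $k=1,\ldots,n!$, of the dynamical system $$\dot\rho(t)=-i[H_0+f(\rho)H_1,\rho(t)],\qquad f(\rho)=\mathrm{Tr}([-iH_1,\rho(t)]\rho_d)$$ on $\mathcal{M}$ are hyperbolic, i.e. for every $k$ all eigenvalues of the linearization $D_f(\vec s^{(k)})$ restricted to $S_{\mathcal T}$ have nonzero real parts. Among these stationary states $\rho_d$ is the only sink, and all other points are saddles except the global maximum (of $V$), which is a source.
   Context: A density operator is a positive semidefinite Hermitian $n\times n$ matrix of trace $1$; it is generic if it has $n$ distinct eigenvalues. $\mathcal{M}$ is the manifold of density operators with the same spectrum as $\rho_d$. $V(\rho)=\frac12\mathrm{Tr}[(\rho-\rho_d)^2]$. One works in a basis in which $H_0=\mathrm{diag}(a_1,\ldots,a_n)$, $a_1\ge\cdots\ge a_n$ (so $\rho_d$ is diagonal); $H_1$ is Hermitian. With $\omega_{k\ell}=a_\ell-a_k$ and $b_{k\ell}$ the $(k,\ell)$ entry of $H_1$, the Hamiltonian is ideal if (i) for $k\ne\ell$, $p\ne q$, $\omega_{k\ell}\ne\omega_{pq}$ unless $(k,\ell)=(p,q)$; and (ii) $b_{k\ell}\ne0$ except (possibly) for $k=\ell$. The stationary states are the $n!$ diagonal density operators in $\mathcal M$, obtained by permuting the diagonal entries of $\rho_d$; they are also the critical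 points of $V$ on $\mathcal{M}$. Bloch representation: let $\{\xi_m\}_{m=1}^{n^2}$ be an orthonormal basis (for $\langle A,B\rangle=\mathrm{Tr}(AB)$) of the Hermitian $n\times n$ matrices with $\xi_{n^2}=\frac1{\sqrt n}I$; a density operator $\rho$ is represented by $\vec s\in\mathbb{R}^{n^2-1}$, $s_m=\mathrm{Tr}(\rho\xi_m)$, and $\vec s_d$ is the vector of $\rho_d$. With the antisymmetric matrices $A_j(m,m')=\mathrm{Tr}(iH_j[\xi_m,\xi_{m'}])$, $j=0,1$, the system reads $\dot{\vec s}=(A_0+(\vec s_d^{\,T}A_1\vec s)A_1)\vec s$, and its linearization at a stationary point $\vec s_0$ is $D_f(\vec s_0)=A_0+A_1\vec s_0\,\vec s_d^{\,T}A_1$. $S_{\mathcal T}\subset\mathbb{R}^{n^2-1}$ is the $(n^2-n)$-dimensional subspace corresponding to Hermitian matrices with zero diagonal; it is invariant under $D_f(\vec s_0)$ and is the tangent space of (the image of) $\mathcal M$ at the stationary points. A hyperbolic stationary point is a sink (source) if all eigenvalues of the restricted linearization have negative (positive) real parts, and a saddle if eigenvalues with negative and with positive real parts both occur. *)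

(* Defs.v *)
From HB Require Import structures.
From mathcomp Require Import all_boot all_order all_algebra.
From mathcomp Require Import boolp classical_sets functions reals topology normedtype derive.
From mathcomp Require Import complex.

Set Implicit Arguments.
Unset Strict Implicit.
Unset Printing Implicit Defensive.

Import Order.TTheory GRing.Theory Num.Theory numFieldNormedType.Exports.

Local Open Scope ring_scope.
Local Open Scope complex_scope.
Local Open Scope sesquilinear_scope.

Section Quantum.
Variables (R : realType) (n : nat).
Local Notation C := R[i].
Implicit Types (A B H rho rhod sigma : 'M[C]_n).

Definition commutator A B : 'M[C]_n := A *m B - B *m A.

(* The trace form Tr(AB) takes real values on Hermitian matrices, where it is
   a real inner product; Re only converts that value from R[i] to R. *)
Definition hs A B : R := complex.Re (\tr (A *m B)).

Definition psdmx A : Prop :=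
  A \is hermsymmx /\ forall v : 'cV[C]_n, 0 <= (v ^t* *m A *m v) 0 0.

Definition density rho : Prop := psdmx rho /\ \tr rho = 1.

Definition generic rho : Prop :=
  exists2 l : n.-tuple C, uniq l & {in l, forall z, eigenvalue rho z}.

(* The characteristic polynomial records the spectrum with multiplicities. *)
Definition isospectral rhod rho : Prop :=
  density rho /\ char_poly rho = char_poly rhod.

Definition lyapunov rhod rho : R := 2^-1 * hs (rho - rhod) (rho - rhod).

Definition lyapunov_global_max rhod rho : Prop :=
  isospectral rhod rho /\
  forall sigma, isospectral rhod sigma -> lyapunov rhod sigma <= lyapunov rhod rho.

Definition nonincreasing_energies (a : 'I_n -> R) : Prop :=
  forall k l : 'I_n, (k <= l)%N -> a l <= a k.

Definition H0 (a : 'I_n -> R) : 'M[C]_n := diag_mx (\row_k (a k)%:C).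

Definition omega (a : 'I_n -> R) (k l : 'I_n) : R := a l - a k.

Definition ideal (a : 'I_n -> R) (H1 : 'M[C]_n) : Prop :=
  (forall k l p q : 'I_n, k != l -> p != q ->
     omega a k l = omega a p q -> (k, l) = (p, q)) /\
  (forall k l : 'I_n, k != l -> H1 k l != 0).

Definition feedback H1 rhod rho : R := hs (commutator (- 'i%C *: H1) rho) rhod.

Definition vfield (a : 'I_n -> R) H1 rhod rho : 'M[C]_n :=
  - 'i%C *: commutator (H0 a + (feedback H1 rhod rho)%:C *: H1) rho.

Definition stationary_state (a : 'I_n -> R) H1 rhod rho : Prop :=
  isospectral rhod rho /\ vfield a H1 rhod rho = 0.

(* For n >= 1 the index set 'I_(n ^ 2).-1.+1 has n ^ 2 elements; its last
   element ord_max indexes the normalized identity, and the (n ^ 2).-1 others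
   are the Bloch coordinates. *)
Definition bloch_basis (xi : 'I_(n ^ 2).-1.+1 -> 'M[C]_n) : Prop :=
  [/\ forall m, xi m \is hermsymmx,
      forall m m', \tr (xi m *m xi m') = (m == m')%:R,
      forall A, A \is hermsymmx ->
        exists c : 'I_(n ^ 2).-1.+1 -> R, A = \sum_m (c m)%:C *: xi m &
      xi ord_max = ((Num.sqrt n%:R)^-1 : R)%:C%:M].

Section Bloch.
Variable xi : 'I_(n ^ 2).-1.+1 -> 'M[C]_n.

Definition bloch_xi (m : 'I_(n ^ 2).-1) : 'M[C]_n := xi (widen_ord (leqnSn _) m).

(* Bloch vectors are row vectors, as for the library's jacobian. *)
Definition bloch rho : 'rV[R]_(n ^ 2).-1 := \row_m hs rho (bloch_xi m).

Definition traceless_mx (s : 'rV[R]_(n ^ 2).-1) : 'M[C]_n :=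
  \sum_m (s 0 m)%:C *: bloch_xi m.

Definition bloch_inv (s : 'rV[R]_(n ^ 2).-1) : 'M[C]_n :=
  n%:R^-1%:M + traceless_mx s.

Definition bloch_field (a : 'I_n -> R) H1 rhod (s : 'rV[R]_(n ^ 2).-1) :
    'rV[R]_(n ^ 2).-1 :=
  bloch (vfield a H1 rhod (bloch_inv s)).

(* D_f(s), acting on row vectors by v |-> v *m linearization: the transpose of
   the Jacobian matrix in the column-vector convention (see linearizationE). *)
Definition linearization (a : 'I_n -> R) H1 rhod (s : 'rV[R]_(n ^ 2).-1) :
    'M[R]_((n ^ 2).-1) :=
  jacobian (bloch_field a H1 rhod) s.

Definition S_T (s : 'rV[R]_(n ^ 2).-1) : Prop :=
  forall k, traceless_mx s k k = 0.

Definition bloch_A H : 'M[R]_((n ^ 2).-1) :=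
  \matrix_(m, m') complex.Re (\tr ('i%C *: H *m commutator (bloch_xi m) (bloch_xi m'))).

End Bloch.
End Quantum.

(* Complex eigenvalues of the real operator v |-> v *m D restricted to the
   (invariant) real subspace S: the eigenvector lies in the complexification
   of S, i.e. its real and imaginary parts lie in S. *)
Definition restricted_eigenvalue (R : realType) (N : nat) (D : 'M[R]_N)
    (S : 'rV[R]_N -> Prop) (z : R[i]) : Prop :=
  exists v : 'rV[R[i]]_N,
    [/\ v != 0, S (map_mx (@complex.Re R) v), S (map_mx (@complex.Im R) v) &
        v *m map_mx (real_complex R) D = z *: v].

Section Hyperbolicity.
Variables (R : realType) (n : nat) (xi : 'I_(n ^ 2).-1.+1 -> 'M[R[i]]_n).
Variables (a : 'I_n -> R) (H1 rhod : 'M[R[i]]_n).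

Definition T_eigenvalue (rho : 'M[R[i]]_n) (z : R[i]) : Prop :=
  restricted_eigenvalue (linearization xi a H1 rhod (bloch xi rho))
    (S_T xi) z.

Definition hyperbolic rho : Prop := forall z, T_eigenvalue rho z -> complex.Re z != 0.

Definition sink rho : Prop := forall z, T_eigenvalue rho z -> complex.Re z < 0.

Definition source rho : Prop := forall z, T_eigenvalue rho z -> 0 < complex.Re z.

Definition saddle rho : Prop :=
  (exists2 z, T_eigenvalue rho z & complex.Re z < 0) /\
  (exists2 z, T_eigenvalue rho z & 0 < complex.Re z).

End Hyperbolicity.

Section MatrixDifferential.
Variables (R : realType) (N : nat).
Implicit Types (s v : 'rV[R]_N).

Lemma is_diff_bigsum (W : normedModType R) I (r : seq I)
    (f df : I -> 'rV[R]_N -> W) s :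
  (forall i, is_diff s (f i) (df i)) ->
  is_diff s (fun v => \sum_(i <- r) f i v) (fun v => \sum_(i <- r) df i v).
Proof.
move=> fdf; elim: r => [|i r IHr].
  have -> : (fun v => \sum_(i <- [::]) f i v) = cst 0.
    by apply/funext => v; rewrite big_nil.
  have -> : (fun v => \sum_(i <- [::]) df i v) = 0.
    by apply/funext => v; rewrite big_nil.
  exact: is_diff_cst.
have -> : (fun v => \sum_(k <- i :: r) f k v) =
    f i + (fun v => \sum_(k <- r) f k v).
  by apply/funext => v; rewrite big_cons.
have -> : (fun v => \sum_(k <- i :: r) df k v) =
    df i + (fun v => \sum_(k <- r) df k v).
  by apply/funext => v; rewrite big_cons.
exact: is_diffD.
Qed.

Lemma is_diff_coord s j : is_diff s (fun v => v 0 j : R) (fun v => v 0 j).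
Proof.
have lin : linear (fun v => v 0 j : R) by move=> c u v; rewrite !mxE.
pose f : {linear 'rV[R]_N -> R} :=
  HB.pack (fun v => v 0 j : R) (GRing.isLinear.Build _ _ _ _ _ lin).
have fc : continuous f by exact: coord_continuous.
change (is_diff s f f); apply: DiffDef; first exact: linear_differentiable.
exact: diff_lin.
Qed.

Lemma is_diff_scale_cst (W : normedModType R) (k dk : 'rV[R]_N -> R) (w : W) s :
  is_diff s k dk -> is_diff s (fun v => k v *: w) (fun v => dk v *: w).
Proof. by move=> kdk; apply: (is_diff_comp kdk (is_diff_scalel _ w)). Qed.

Lemma is_diff_mulmxr M (B : 'M[R]_(N, M)) s :
  is_diff s (fun v => v *m B) (fun v => v *m B).
Proof.
have -> : (fun v => v *m B) = (fun v => \sum_j v 0 j *: row j B).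
  by apply/funext => v; rewrite mulmx_sum_row.
apply: is_diff_bigsum => j; exact: is_diff_scale_cst (is_diff_coord _ _).
Qed.

Lemma is_diff_quadratic M (u : 'cV[R]_N) (B : 'M[R]_(N, M)) s :
  is_diff s (fun v => (v *m u) 0 0 *: (v *m B))
    (fun v => (s *m u) 0 0 *: (v *m B) + (v *m u) 0 0 *: (s *m B)).
Proof.
have -> : (fun v => (v *m u) 0 0 *: (v *m B)) =
    (fun v => \sum_j ((v *m u) 0 0 * v 0 j) *: row j B).
  apply/funext => v; rewrite (mulmx_sum_row v B) scaler_sumr.
  by apply: eq_bigr => j _; rewrite scalerA.
have -> : (fun v => (s *m u) 0 0 *: (v *m B) + (v *m u) 0 0 *: (s *m B)) =
    (fun v => \sum_j ((s *m u) 0 0 * v 0 j + s 0 j * (v *m u) 0 0) *: row j B).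
  apply/funext => v; rewrite (mulmx_sum_row v B) (mulmx_sum_row s B) !scaler_sumr -big_split /=.
  by apply: eq_bigr => j _; rewrite !scalerA -scalerDl [s 0 j * _]mulrC.
apply: is_diff_bigsum => j; apply: is_diff_scale_cst.
have du : is_diff s (fun v => (v *m u) 0 0 : R) (fun v => (v *m u) 0 0).
  have E : (fun v => (v *m u) 0 0 : R) = (fun v => \sum_j v 0 j *: u j 0).
    by apply/funext => v; rewrite mxE.
  rewrite E; apply: is_diff_bigsum => k.
  exact: is_diff_scale_cst (is_diff_coord _ _).
exact: (is_diffM du (is_diff_coord s j)).
Qed.

End MatrixDifferential.

Section BlochTheory.
Variables (R : realType) (n : nat) (xi : 'I_(n ^ 2).-1.+1 -> 'M[R[i]]_n).
Implicit Types (A B H K rho : 'M[R[i]]_n) (s : 'rV[R]_(n ^ 2).-1).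

Let ReD (x y : R[i]) : complex.Re (x + y) = complex.Re x + complex.Re y.
Proof. by case: x y => [? ?] []. Qed.

Let ReZ (c : R) (x : R[i]) : complex.Re (c%:C * x) = c * complex.Re x.
Proof. by case: x => x y /=; rewrite mul0r subr0. Qed.

Let Re_sum I (r : seq I) (F : I -> R[i]) :
  complex.Re (\sum_(i <- r) F i) = \sum_(i <- r) complex.Re (F i).
Proof. exact: (big_morph (@complex.Re R) ReD). Qed.

Lemma trace_commutator H A B :
  \tr (commutator H A *m B) = \tr (H *m commutator A B).
Proof.
rewrite /commutator mulmxBl mulmxBr !raddfB /= mulmxA; congr (_ - _).
by rewrite -mulmxA [LHS]mxtrace_mulC mulmxA.
Qed.

Lemma commutatorZl (c : R[i]) A B : commutator (c *: A) B = c *: commutator A B.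
Proof. by rewrite /commutator -scalemxAl -scalemxAr scalerBr. Qed.

Lemma commutator_bloch_inv s B :
  commutator (bloch_inv xi s) B = \sum_m (s 0 m)%:C *: commutator (bloch_xi xi m) B.
Proof.
rewrite /commutator /bloch_inv /traceless_mx mulmxDl mulmxDr.
rewrite mul_scalar_mx mul_mx_scalar opprD addrACA subrr add0r.
rewrite mulmx_suml mulmx_sumr -sumrB; apply: eq_bigr => m _.
by rewrite -scalemxAl -scalemxAr scalerBr.
Qed.

Lemma hs_commutator_bloch H s m :
  hs (- 'i *: commutator H (bloch_inv xi s)) (bloch_xi xi m) =
  (s *m (bloch_A xi H)^T) 0 m.
Proof.
rewrite /hs -scalemxAl mxtraceZ trace_commutator commutator_bloch_inv.
rewrite mulmx_sumr raddf_sum mulr_sumr Re_sum mxE /=; apply: eq_bigr => m' _.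
rewrite -scalemxAr mxtraceZ mulrCA ReZ !mxE; congr (_ * complex.Re _).
rewrite -scalemxAl mxtraceZ mulNr -mulrN -raddfN /= -mulmxN.
by rewrite /commutator opprB.
Qed.

Lemma bloch_AD H K : bloch_A xi (H + K) = bloch_A xi H + bloch_A xi K.
Proof.
by apply/matrixP => m m'; rewrite !mxE scalerDr mulmxDl mxtraceD ReD.
Qed.

Lemma bloch_AZ (c : R) H : bloch_A xi (c%:C *: H) = c *: bloch_A xi H.
Proof.
apply/matrixP => m m'; rewrite !mxE scalerA mulrC -scalerA -scalemxAl.
by rewrite mxtraceZ ReZ.
Qed.

Hypothesis n_gt0 : (0 < n)%N.
Hypothesis xiP : bloch_basis xi.

Lemma blochK rho : rho \is hermsymmx -> \tr rho = 1 ->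
  bloch_inv xi (bloch xi rho) = rho.
Proof.
case: xiP => herm ortho span xilast rho_herm rho1.
have [c rhoE] := span _ rho_herm.
have cE m : (c m)%:C = \tr (rho *m xi m).
  rewrite rhoE mulmx_suml raddf_sum (bigD1 m) //= big1 => [|m' ne].
    by rewrite -scalemxAl mxtraceZ ortho eqxx mulr1 addr0.
  by rewrite -scalemxAl mxtraceZ ortho (negbTE ne) mulr0.
rewrite [RHS]rhoE big_ord_recr /= addrC /bloch_inv; congr (_ + _).
  rewrite cE xilast mul_mx_scalar mxtraceZ rho1 mulr1 scale_scalar_mx.
  rewrite -rmorphM /= -invfM -expr2 sqr_sqrtr ?ler0n // fmorphV /=.
  by rewrite rmorph_nat.
apply: eq_bigr => m _; congr (_ *: _).
by rewrite mxE /hs -cE.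
Qed.

Lemma feedback_bloch H1 rhod s : density rhod ->
  feedback H1 rhod (bloch_inv xi s) =
  (bloch xi rhod *m bloch_A xi H1 *m s^T) 0 0.
Proof.
move=> [[rhod_herm _] rhod1]; rewrite /feedback -[in LHS](blochK rhod_herm rhod1).
set sd := bloch xi rhod; rewrite commutatorZl /hs mulmxDr mxtraceD ReD.
rewrite mul_mx_scalar mxtraceZ mxtraceZ /commutator raddfB /=.
rewrite [\tr (H1 *m _)]mxtrace_mulC subrr !mulr0 add0r -/(commutator H1 _).
rewrite /traceless_mx mulmx_sumr [X in complex.Re X]raddf_sum Re_sum -mulmxA mxE /=.
apply: eq_bigr => m _; rewrite -scalemxAr mxtraceZ ReZ; congr (_ * _).
have := hs_commutator_bloch H1 s m; rewrite /hs => ->.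
by rewrite -[in LHS](trmxK s) -trmx_mul mxE.
Qed.

Lemma bloch_fieldE (a : 'I_n -> R) H1 rhod s : density rhod ->
  bloch_field xi a H1 rhod s =
  s *m (bloch_A xi (H0 a))^T +
  (bloch xi rhod *m bloch_A xi H1 *m s^T) 0 0 *: (s *m (bloch_A xi H1)^T).
Proof.
move=> rhodP; apply/rowP => m.
rewrite mxE hs_commutator_bloch bloch_AD bloch_AZ feedback_bloch //.
by rewrite linearD linearZ /= mulmxDr -scalemxAr mxE.
Qed.

Lemma linearizationE (a : 'I_n -> R) H1 rhod s : density rhod ->
  let A0 := bloch_A xi (H0 a) in
  let A1 := bloch_A xi H1 in
  let sd := bloch xi rhod in
  linearization xi a H1 rhod s =
  (A0 + (sd *m A1 *m s^T) 0 0 *: A1 + A1 *m s^T *m sd *m A1)^T.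
Proof.
move=> rhodP A0 A1 sd; rewrite /linearization.
have fE (v : 'rV[R]_((n ^ 2).-1)) : (sd *m A1 *m v^T) 0 0 = (v *m (sd *m A1)^T) 0 0.
  by rewrite -[in RHS](trmxK v) -trmx_mul [RHS]mxE.
have -> : bloch_field xi a H1 rhod = (fun v => v *m A0^T) +
    (fun v => (v *m (sd *m A1)^T) 0 0 *: (v *m A1^T)).
  by apply/funext => v; rewrite bloch_fieldE // fE.
have [_ dE] := is_diffD (is_diff_mulmxr A0^T s)
  (is_diff_quadratic (sd *m A1)^T A1^T s).
rewrite /jacobian; apply/row_matrixP => i.
rewrite 2!rowE mul_rV_lin1 dE /=.
have -> (A B C : 'M[R]_((n ^ 2).-1)) (c : R) :
    (A + c *: B + C)^T = A^T + c *: B^T + C^T by rewrite !linearD linearZ.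
rewrite !mulmxDr -scalemxAr -fE -addrA; congr (_ + (_ + _)).
rewrite -[A1 *m s^T *m sd *m A1]mulmxA [(A1 *m s^T *m _)^T]trmx_mul mulmxA [(A1 *m s^T)^T]trmx_mul trmxK.
by rewrite -mul_scalar_mx -mx11_scalar.
Qed.

(* At a stationary state the middle term vanishes. *)
Corollary linearization_commuting (a : 'I_n -> R) H1 rhod rho :
  density rhod -> density rho -> commutator rho rhod = 0 ->
  let A0 := bloch_A xi (H0 a) in
  let A1 := bloch_A xi H1 in
  linearization xi a H1 rhod (bloch xi rho) =
  (A0 + A1 *m (bloch xi rho)^T *m bloch xi rhod *m A1)^T.
Proof.
move=> rhodP rhoP rhoC A0 A1; rewrite linearizationE // -feedback_bloch //.
have [[rho_herm _] rho1] := rhoP; rewrite blochK //.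
by rewrite /feedback /hs trace_commutator rhoC mulmx0 mxtrace0 scale0r addr0.
Qed.

End BlochTheory.

(* Main.v *)
(* At a diagonal state with entries r the linearization, read on matrices with
   zero diagonal, is a rank one perturbation of diag(i w_j), where j runs over
   the pairs (k, l) with k <> l and w_j = a_l - a_k.  Since the w_j are distinct
   its eigenvalues are the solutions of  sum_j c_j / (z - i w_j) = 1  with the
   real weights  c_j = - |b_kl|^2 (r_l - r_k) (d_l - d_k) <> 0,  where d is the
   diagonal of rhod.  The left side is imaginary on the imaginary axis, hence
   hyperbolicity, and weights of one sign put every eigenvalue in one half
   plane.  Conversely the logarithmic derivative of the secular polynomial at
   i w_j yields  1 / c_j = sum_z Re z / |i w_j - z|^2  over the eigenvalues z, so
   weights of both signs force eigenvalues in both half planes.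

   On isospectral states V is a constant minus Tr(sigma rhod).  Writing sigma in
   a unitary eigenbasis turns this trace into the cost of a doubly stochastic
   matrix, minimal only at the antitone rearrangement of d: optimal transport
   potentials certify this. *)

Require Import Defs.
From mathcomp Require Import all_boot all_order all_algebra.
From mathcomp Require Import boolp classical_sets reals topology normedtype derive.
From mathcomp Require Import perm complex ring lra zify.

Set Implicit Arguments.
Unset Strict Implicit.
Unset Printing Implicit Defensive.

Import Order.TTheory GRing.Theory Num.Theory numFieldNormedType.Exports.

Local Open Scope ring_scope.

(** * Secular equation of a rank one perturbation *)

Lemma horner_deriv_prod_XsubC (F : fieldType) (I : Type) (r : seq I)
    (P : pred I) (x : I -> F) (y : F) :
  (forall i, P i -> y != x i) ->
  (\prod_(i <- r | P i) ('X - (x i)%:P))^`().[y] =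
  (\prod_(i <- r | P i) (y - x i)) * \sum_(i <- r | P i) (y - x i)^-1.
Proof.
move=> yx; elim: r => [|i r IHr]; first by rewrite !big_nil derivC horner0 mulr0.
rewrite !big_cons; case: ifP => // Pi.
rewrite derivM derivXsubC hornerD !hornerM hornerC hornerXsubC IHr horner_prod.
under eq_bigr do rewrite hornerXsubC.
rewrite mul1r mulrDr mulrAC mulfV ?subr_eq0 ?yx // mul1r; congr (_ + _).
by rewrite mulrA.
Qed.

Lemma horner_log_deriv_prod_XsubC (F : fieldType) (r : seq F) (y : F) :
  {in r, forall z, y != z} ->
  (\prod_(z <- r) ('X - z%:P))^`().[y] / (\prod_(z <- r) ('X - z%:P)).[y] =
  \sum_(z <- r) (y - z)^-1.
Proof.
move=> yr; rewrite !big_seq horner_deriv_prod_XsubC // horner_prod.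
under [X in _ / X]eq_bigr do rewrite hornerXsubC.
rewrite mulrAC divff ?mul1r //.
by rewrite -big_seq prodf_seq_neq0; apply/allP => z zr; rewrite subr_eq0 yr.
Qed.

Section Secular.
Variables (F : fieldType) (J : finType) (x c : J -> F).
Hypothesis x_inj : injective x.

(** The numerator of [1 - \sum_j c j / ('X - x j)] over the common denominator. Being a polynomial,
    it can also be evaluated at the poles [x j]. *)
Definition secular_poly : {poly F} :=
  \prod_j ('X - (x j)%:P) - \sum_j c j *: \prod_(l | l != j) ('X - (x l)%:P).

(** The value at [x j] of the derivative of the full product [\prod_l ('X - (x l)%:P)]. *)
Let q (j : J) : F := \prod_(l | l != j) (x j - x l).

Let xB j l : l != j -> x j - x l != 0.
Proof. by move=> lj; rewrite subr_eq0 (inj_eq x_inj) eq_sym. Qed.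

Let q_neq0 j : q j != 0.
Proof. by apply/prodf_neq0 => l; exact: xB. Qed.

(** Isolates the pole [x j]: all terms but the last carry the factor ['X - x j], so value and
    derivative at [x j] can be read off. *)
Let secular_polyE j : secular_poly =
  ('X - (x j)%:P) * (\prod_(l | l != j) ('X - (x l)%:P) -
     \sum_(l | l != j) c l *: \prod_(m | (m != l) && (m != j)) ('X - (x m)%:P))
  - c j *: \prod_(l | l != j) ('X - (x l)%:P).
Proof.
rewrite /secular_poly (bigD1 j) //= [in X in _ - X](bigD1 j) //= mulrBr.
rewrite opprD addrA addrAC; congr (_ - _ - _).
rewrite mulr_sumr; apply: eq_bigr => l lj.
by rewrite -scalerAr [in LHS](bigD1 j) //= eq_sym.
Qed.

Lemma secular_poly_pole j : secular_poly.[x j] = - c j * q j.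
Proof.
rewrite (secular_polyE j) hornerD hornerM hornerXsubC subrr mul0r add0r.
rewrite hornerN hornerZ horner_prod mulNr; congr (- (_ * _)).
by apply: eq_bigr => l _; rewrite hornerXsubC.
Qed.

Lemma secular_poly_neq0 j : c j != 0 -> secular_poly != 0.
Proof.
move=> cj; apply/negP => /eqP p0; have := secular_poly_pole j.
by rewrite p0 horner0 => /esym/eqP; rewrite mulf_eq0 oppr_eq0 (negbTE cj) (negbTE (q_neq0 j)).
Qed.

Lemma root_secular_poly z : (forall j, z != x j) ->
  root secular_poly z = (\sum_j c j / (z - x j) == 1).
Proof.
move=> zx; have zB j : z - x j != 0 by rewrite subr_eq0.
have -> : \sum_j c j / (z - x j) = 1 - secular_poly.[z] / \prod_j (z - x j).
  have Q0 : \prod_j (z - x j) != 0 by apply/prodf_neq0 => j _.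
  apply: (mulIf Q0); rewrite mulrBl mul1r mulfVK // /secular_poly hornerD hornerN.
  rewrite horner_prod; under [X in _ = _ - (X - _)]eq_bigr do rewrite hornerXsubC.
  rewrite opprB addrC subrK horner_sum mulr_suml; apply: eq_bigr => j _.
  rewrite hornerZ horner_prod (bigD1 j) //= mulrA mulfVK //; congr (_ * _).
  by apply: eq_bigr => l _; rewrite hornerXsubC.
have Q0 : (\prod_j (z - x j))^-1 != 0 by rewrite invr_eq0; apply/prodf_neq0 => j _.
rewrite -subr_eq0 addrAC subrr add0r oppr_eq0 mulf_eq0 (negbTE Q0) orbF.
by [].
Qed.

(** This form separates [- (c j)^-1] from a sum that is purely imaginary once the poles are
    imaginary and the weights real. *)
Lemma secular_poly_log_deriv j : c j != 0 ->
  secular_poly^`().[x j] / secular_poly.[x j] =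
  - (c j)^-1 + \sum_(l | l != j) (c l / c j + 1) / (x j - x l).
Proof.
move=> cj; have qE : \prod_(l | l != j) (x j - x l) = q j by [].
have -> : secular_poly^`().[x j] =
    q j * (1 - \sum_(l | l != j) c l / (x j - x l)
             - c j * \sum_(l | l != j) (x j - x l)^-1).
  rewrite (secular_polyE j) derivB derivM derivXsubC derivZ !(hornerD, hornerN) !hornerM.
  rewrite hornerXsubC subrr mul0r addr0 hornerC mul1r hornerZ !(hornerD, hornerN).
  rewrite horner_deriv_prod_XsubC; last by move=> l lj; rewrite -subr_eq0 xB.
  rewrite qE horner_prod; under eq_bigr do rewrite hornerXsubC.
  rewrite qE !mulrBr mulr1 mulrCA; congr (_ - _ - _).
  rewrite horner_sum mulr_sumr; apply: eq_bigr => l lj.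
  rewrite hornerZ horner_prod mulrCA; congr (_ * _); rewrite /q [in RHS](bigD1 l) //=.
  rewrite [RHS]mulrAC mulfV ?xB // mul1r; apply: eq_big => [m|m _]; first by rewrite andbC.
  by rewrite hornerXsubC.
have -> : \sum_(l | l != j) (c l / c j + 1) / (x j - x l) =
    (\sum_(l | l != j) c l / (x j - x l)) / c j + \sum_(l | l != j) (x j - x l)^-1.
  rewrite mulr_suml -big_split /=; apply: eq_bigr => l _.
  by rewrite mulrDl mul1r mulrAC.
by rewrite secular_poly_pole; field; rewrite oppr_eq0 cj q_neq0.
Qed.

End Secular.

(** * Imaginary poles and real weights: half planes of the eigenvalues *)

Section SecularComplex.
Variables (R : rcfType) (J : finType) (w c : J -> R).
Hypothesis w_inj : injective w.
Hypothesis c_neq0 : forall j, c j != 0.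
Local Notation C := R[i].

Let x (j : J) : C := 'i%C * (w j)%:C%C.
Let cC (j : J) : C := (c j)%:C%C.

Lemma complex_ReD (y z : C) : complex.Re (y + z) = complex.Re y + complex.Re z.
Proof. by case: y z => [? ?] []. Qed.

Lemma complex_Re_sum I (r : seq I) (P : pred I) (f : I -> C) :
  complex.Re (\sum_(i <- r | P i) f i) = \sum_(i <- r | P i) complex.Re (f i).
Proof. exact: (big_morph (@complex.Re R) complex_ReD). Qed.

Lemma complex_ReZ (b : R) (z : C) : complex.Re (b%:C%C * z) = b * complex.Re z.
Proof. by case: z => y z /=; rewrite mul0r subr0. Qed.

Lemma complex_Re_inv (z : C) : complex.Re z^-1 =
  complex.Re z / (complex.Re z ^+ 2 + complex.Im z ^+ 2).
Proof. by case: z. Qed.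

Lemma complex_sqr_gt0 (z : C) : z != 0 ->
  0 < complex.Re z ^+ 2 + complex.Im z ^+ 2.
Proof.
rewrite eq_complex negb_and /= => z0.
by rewrite lt0r addr_ge0 ?sqr_ge0 // andbT paddr_eq0 ?sqr_ge0 // !sqrf_eq0 negb_and.
Qed.

Let x_inj : injective x.
Proof.
move=> j l /(congr1 (@complex.Im R)).
by rewrite /= !mul0r !mul1r !add0r; exact: w_inj.
Qed.

Let Re_x j : complex.Re (x j) = 0.
Proof. by rewrite /x /= mul0r mul1r subrr. Qed.

Let ReN (z : C) : complex.Re (- z) = - complex.Re z.
Proof. by case: z. Qed.

(** The logarithmic derivative at the pole [x j] is computed twice, from the factorization over the
    roots and from the weights, and real parts are compared. The pole is not a root because [c j] is
    nonzero. *)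
Lemma inv_weight_eq_sum_roots (j : J) (r : seq C) :
    secular_poly x cC = lead_coef (secular_poly x cC) *: \prod_(z <- r) ('X - z%:P) ->
  (c j)^-1 = \sum_(z <- r) complex.Re z /
     (complex.Re (x j - z) ^+ 2 + complex.Im (x j - z) ^+ 2).
Proof.
set p := secular_poly x cC => pE.
have cCj : cC j != 0 by rewrite eq_complex /= negb_and c_neq0.
have px : p.[x j] != 0.
  rewrite secular_poly_pole // mulf_neq0 ?oppr_eq0 //.
  by apply/prodf_neq0 => l lj; rewrite subr_eq0 (inj_eq x_inj) eq_sym.
have xr z : z \in r -> x j != z.
  move=> zr; apply: contra px => /eqP->; rewrite pE hornerZ mulf_eq0.
  by rewrite -/(root _ z) root_prod_XsubC zr orbT.
have := secular_poly_log_deriv x_inj cCj; rewrite -/p.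
have -> : p^`().[x j] / p.[x j] = \sum_(z <- r) (x j - z)^-1.
  have l0 : lead_coef p != 0.
    by apply: contra px => /eqP l0; rewrite pE l0 scale0r horner0.
  rewrite pE derivZ !hornerZ -mulf_div divff // mul1r.
  exact: horner_log_deriv_prod_XsubC.
move=> /(congr1 (@complex.Re R)); rewrite complex_ReD !complex_Re_sum.
(* Each remaining term is a real number divided by the imaginary [x j - x l], so its real part
   vanishes. *)
rewrite [X in _ = _ + X]big1 => [|l lj]; last first.
  rewrite -fmorphV -rmorphM -(rmorph1 (real_complex R)) -rmorphD complex_ReZ.
  by rewrite complex_Re_inv complex_ReD ReN !Re_x subrr mul0r mulr0.
rewrite addr0 -fmorphV ReN /= => /eqP; rewrite -eqr_oppLR => /eqP<-.
rewrite -sumrN; apply: eq_bigr => z _.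
by rewrite complex_Re_inv complex_ReD ReN Re_x add0r mulNr opprK.
Qed.

(** The eigenvalue equation of [diag(x) + u v^T], written in coordinates so that any finite type [J]
    can index them. *)
Definition rank_one_eigenvalue (u v : J -> C) (z : C) : Prop :=
  exists2 X : J -> C, exists j, X j != 0 &
    forall j, x j * X j + (\sum_l v l * X l) * u j = z * X j.

Section RankOne.
Variables u v : J -> C.
Hypothesis uv : forall j, u j * v j = cC j.
Local Notation p := (secular_poly x cC).
Local Notation ev := (rank_one_eigenvalue u v).

Let cC_neq0 j : cC j != 0.
Proof. by rewrite eq_complex /= negb_and c_neq0. Qed.

Let u_neq0 j : u j != 0.
Proof. by apply: contra (cC_neq0 j) => /eqP u0; rewrite -uv u0 mul0r. Qed.

Let v_neq0 j : v j != 0.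
Proof. by apply: contra (cC_neq0 j) => /eqP v0; rewrite -uv v0 mulr0. Qed.

(** With [g = v^T X], the equation reads [(z - x j) X j = g u j]. Solving for [X j], pairing with
    [v] and cancelling [g] gives the secular equation. *)
Lemma rank_one_eigenvalue_secular z : ev z ->
  (forall j, z != x j) /\ \sum_j cC j / (z - x j) = 1.
Proof.
case=> X [k Xk] XP; set g := \sum_l v l * X l in XP.
have XE j : (z - x j) * X j = g * u j by rewrite mulrBl -XP addrC addKr.
(* If [g = 0], then [X] is supported on the single index [k] with [x k = z], since the poles are
   distinct; then [g = v k * X k], which is nonzero. *)
have g0 : g != 0.
  apply/eqP => g0; have zk : z = x k.
    by apply/eqP; rewrite -subr_eq0; have /eqP := XE k;
      rewrite g0 mul0r mulf_eq0 (negbTE Xk) orbF.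
  have : g = v k * X k.
    rewrite /g (bigD1 k) //= big1 ?addr0 // => j jk.
    have /eqP := XE j; rewrite g0 mul0r mulf_eq0 zk subr_eq0 (inj_eq x_inj) eq_sym.
    by rewrite (negbTE jk) => /eqP->; rewrite mulr0.
  by move/eqP; rewrite g0 eq_sym mulf_eq0 (negbTE Xk) (negbTE (v_neq0 k)).
have zx j : z != x j.
  apply/eqP => zj; have /eqP := XE j; rewrite zj subrr mul0r eq_sym.
  by rewrite mulf_eq0 (negbTE g0) (negbTE (u_neq0 j)).
split => //; apply: (mulfI g0); rewrite mulr1 mulr_sumr.
apply: eq_bigr => j _; have zB : z - x j != 0 by rewrite subr_eq0.
apply: (mulfI zB); rewrite -uv [RHS]mulrCA XE; field.
exact: zB.
Qed.

(** The eigenvector is [u k / (z - x k)], normalized so that its pairing with [v] is 1; the index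
    [j] witnesses that it is nonzero. *)
Lemma root_secular_rank_one_eigenvalue (j : J) z : root p z -> ev z.
Proof.
move=> rz.
have zx k : z != x k.
  apply: contraTneq rz => ->; rewrite rootE secular_poly_pole // mulf_neq0 ?oppr_eq0 //.
  by apply/prodf_neq0 => l lk; rewrite subr_eq0 (inj_eq x_inj) eq_sym.
have zB k : z - x k != 0 by rewrite subr_eq0.
move: rz; rewrite root_secular_poly // => /eqP s1.
exists (fun k => u k / (z - x k)).
  by exists j; rewrite mulf_neq0 ?invr_eq0.
move=> k; rewrite (_ : \sum_l _ = 1); last first.
  by rewrite -s1; apply: eq_bigr => l _; rewrite mulrA [v l * _]mulrC uv.
by rewrite mul1r; field; exact: zB.
Qed.

(** The real part of the secular equation, with [t j] the inverse of the squared distance from [z]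
    to the pole. Hyperbolicity and the two cases of constant sign follow by looking at signs. *)
Lemma rank_one_eigenvalue_Re z : ev z ->
  exists2 t : J -> R, (forall j, 0 <= t j) &
    complex.Re z * \sum_j c j * t j = 1.
Proof.
move=> /rank_one_eigenvalue_secular[zx /(congr1 (@complex.Re R))].
rewrite complex_Re_sum => s1.
exists (fun j => (complex.Re (z - x j) ^+ 2 + complex.Im (z - x j) ^+ 2)^-1).
  by move=> j; rewrite invr_ge0 addr_ge0 ?sqr_ge0.
rewrite -[RHS]/(complex.Re (1 : C)) -s1 mulr_sumr; apply: eq_bigr => j _.
by rewrite complex_ReZ complex_Re_inv complex_ReD ReN Re_x subr0 mulrCA.
Qed.

Lemma rank_one_hyperbolic z : ev z -> complex.Re z != 0.
Proof.
move=> /rank_one_eigenvalue_Re[t _ h]; apply/eqP => z0.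
by move/eqP: h; rewrite z0 mul0r eq_sym oner_eq0.
Qed.

Lemma rank_one_stable z : (forall j, c j < 0) -> ev z -> complex.Re z < 0.
Proof.
move=> c0 /rank_one_eigenvalue_Re[t t0 h].
have s0 : \sum_j c j * t j <= 0.
  by apply: sumr_le0 => j _; rewrite mulr_le0_ge0 // ltW.
by rewrite ltNge; apply/negP => z0; have := mulr_ge0_le0 z0 s0; rewrite h ler10.
Qed.

Lemma rank_one_unstable z : (forall j, 0 < c j) -> ev z -> 0 < complex.Re z.
Proof.
move=> c0 /rank_one_eigenvalue_Re[t t0 h].
have s0 : 0 <= \sum_j c j * t j.
  by apply: sumr_ge0 => j _; rewrite mulr_ge0 // ltW.
by rewrite ltNge; apply/negP => z0; have := mulr_le0_ge0 z0 s0; rewrite h ler10.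
Qed.

(** If no root had positive real part, every term of the sum representing [(c j)^-1] would be
    nonpositive. *)
Lemma rank_one_exists_unstable (j : J) : 0 < c j ->
  exists2 z, ev z & 0 < complex.Re z.
Proof.
move=> cj; have [r pE] := closed_field_poly_normal p.
have := inv_weight_eq_sum_roots j pE; set S := \sum_(z <- r) _ => cS.
have : 0 < S by rewrite -cS invr_gt0.
have [/hasP[z zr z0] _|/hasPn nr] := boolP (has (fun z => 0 < complex.Re z) r).
  exists z => //; apply: (root_secular_rank_one_eigenvalue j).
  by rewrite pE rootZ ?root_prod_XsubC // lead_coef_eq0 (secular_poly_neq0 _ (cC_neq0 j)).
rewrite ltNge /S big_seq sumr_le0 // => z /nr; rewrite -leNgt => z0.
by rewrite mulr_le0_ge0 // invr_ge0 addr_ge0 ?sqr_ge0.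
Qed.

Lemma rank_one_exists_stable (j : J) : c j < 0 ->
  exists2 z, ev z & complex.Re z < 0.
Proof.
move=> cj; have [r pE] := closed_field_poly_normal p.
have := inv_weight_eq_sum_roots j pE; set S := \sum_(z <- r) _ => cS.
have : S < 0 by rewrite -cS invr_lt0.
have [/hasP[z zr z0] _|/hasPn nr] := boolP (has (fun z => complex.Re z < 0) r).
  exists z => //; apply: (root_secular_rank_one_eigenvalue j).
  by rewrite pE rootZ ?root_prod_XsubC // lead_coef_eq0 (secular_poly_neq0 _ (cC_neq0 j)).
rewrite ltNge /S big_seq sumr_ge0 // => z /nr; rewrite -leNgt => z0.
by rewrite mulr_ge0 // invr_ge0 addr_ge0 ?sqr_ge0.
Qed.

End RankOne.

End SecularComplex.

(** * Rearrangement *)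

Section Rearrangement.
Variable R : realFieldType.

(* A discrete primitive of the decreasing map [x i |-> y i]: its increments use
   the mean of two consecutive values of [y], so it is strictly concave in [x]. *)
Definition trapezoid (x y : nat -> R) (k : nat) : R :=
  \sum_(0 <= j < k) (x j.+1 - x j) * ((y j + y j.+1) / 2).

(** [y l] is a strict supergradient at [l]: the slopes are below [y l] to the right of [l] and above
    it to the left, and the differences accumulate by induction on the distance. *)
Lemma trapezoid_strictly_concave (x y : nat -> R) (n : nat) :
  (forall i j, (i < j < n)%N -> x i < x j) ->
  (forall i j, (i < j < n)%N -> y j < y i) ->
  forall k l, (k < n)%N -> (l < n)%N -> k != l ->
    trapezoid x y k - trapezoid x y l < (x k - x l) * y l.
Proof.
move=> xinc ydec.
have step k : trapezoid x y k.+1 =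
    trapezoid x y k + (x k.+1 - x k) * ((y k + y k.+1) / 2).
  by rewrite /trapezoid big_nat_recr.
have yle i j : (i <= j < n)%N -> y j <= y i.
  case/andP; rewrite leq_eqVlt => /predU1P[-> //|ij jn].
  by apply/ltW/ydec; rewrite ij.
have up l m : (l + m.+1 < n)%N ->
    trapezoid x y (l + m.+1) - trapezoid x y l < (x (l + m.+1)%N - x l) * y l.
  elim: m => [|m IHm] lm.
    rewrite addn1 in lm *; rewrite step.
    have := xinc l l.+1; rewrite ltnSn lm => /(_ isT) hx.
    have := ydec l l.+1; rewrite ltnSn lm => /(_ isT) hy.
    by nra.
  rewrite addnS in lm *; have lm' : (l + m.+1 < n)%N by lia.
  have := IHm lm'; rewrite step.
  have := xinc (l + m.+1)%N (l + m.+1).+1; rewrite ltnSn lm => /(_ isT) hx.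
  have := ydec (l + m.+1)%N (l + m.+1).+1; rewrite ltnSn lm => /(_ isT) hy.
  have := yle l (l + m.+1)%N; rewrite leq_addr lm' => /(_ isT) hy'.
  by nra.
(* The base point is now the right end, so the induction removes the leftmost step instead of the
   rightmost one. *)
have down m k : (k + m.+1 < n)%N ->
    trapezoid x y k - trapezoid x y (k + m.+1) < (x k - x (k + m.+1)%N) * y (k + m.+1)%N.
  elim: m k => [|m IHm] k km.
    rewrite addn1 in km *; rewrite step.
    have := xinc k k.+1; rewrite ltnSn km => /(_ isT) hx.
    have := ydec k k.+1; rewrite ltnSn km => /(_ isT) hy.
    by nra.
  have := IHm k.+1; rewrite addSnnS => /(_ km); rewrite step.
  have := xinc k k.+1; rewrite ltnSn (leq_ltn_trans _ km) ?addnS ?ltnS ?leq_addr; last by lia.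
  move=> /(_ isT) hx.
  have := ydec k k.+1; rewrite ltnSn (_ : k.+1 < n)%N; last by lia.
  move=> /(_ isT) hy.
  have := yle k.+1 (k + m.+2)%N; rewrite km andbT -addSnnS leq_addr -addnS => /(_ isT) hy'.
  rewrite !addnS in hy' *; by nra.
move=> k l kn ln; rewrite neq_ltn => /orP[kl|lk].
  have -> : l = (k + (l - k).-1.+1)%N by lia.
  by apply: down; lia.
have -> : k = (l + (k - l).-1.+1)%N by lia.
by apply: up; lia.
Qed.

(* [alpha] and [beta] are optimal potentials for the assignment problem with
   costs [d i * e j], whose only optimal assignment is the identity. *)
Lemma antitone_rearrangement (n : nat) (d : 'I_n -> R) : injective d ->
  exists (e : 'I_n -> R) (tau : 'S_n) (alpha beta : 'I_n -> R),
    [/\ forall i, e i = d (tau i),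
        forall i j, d i < d j -> e j < e i,
        forall i, alpha i + beta i = d i * e i &
        forall i j, i != j -> alpha i + beta j < d i * e j].
Proof.
move=> d_inj; set s := sort <=%R [seq d i | i <- enum 'I_n].
have size_s : size s = n by rewrite size_sort size_map size_enum_ord.
have mem_s t : t \in s -> exists i, d i = t.
  by rewrite mem_sort => /mapP[i _ ->]; exists i.
have ds i : d i \in s by rewrite mem_sort map_f // mem_enum.
have uniq_s : uniq s by rewrite sort_uniq map_inj_uniq // enum_uniq.
have sort_s : sorted <%R s by rewrite lt_sorted_uniq_le uniq_s sort_le_sorted.
(* [x] lists the values of [d] increasingly and [y] decreasingly; below [n] the default 0 is never
   reached. *)
pose x k : R := nth 0 s k; pose y k : R := nth 0 s (n.-1 - k)%N.
have xinc i j : (i < j < n)%N -> x i < x j.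
  case/andP=> ij jn; rewrite /x (lt_sorted_ltn_nth 0 sort_s) ?inE ?size_s //.
  exact: ltn_trans jn.
have ydec i j : (i < j < n)%N -> y j < y i.
  by case/andP=> ij jn; apply: xinc; lia.
pose k i := index (d i) s.
have kn i : (k i < n)%N by rewrite -size_s index_mem.
have xk i : x (k i) = d i by rewrite /x nth_index.
have k_inj : injective k by move=> i j kij; apply: d_inj; rewrite -!xk kij.
have /fin_all_exists[t tE] i : exists j, d j = y (k i).
  by apply: mem_s; rewrite mem_nth // size_s; have := kn i; lia.
have t_inj : injective t.
  move=> i j tij; apply/k_inj; have : y (k i) = y (k j) by rewrite -!tE tij.
  case: (ltngtP (k i) (k j)) => // lt_k yE.
    by have := @ydec (k i) (k j); rewrite lt_k kn yE ltxx => /(_ isT).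
  by have := @ydec (k j) (k i); rewrite lt_k kn yE ltxx => /(_ isT).
(* With [alpha] the concave primitive at the rank of [d i], this [beta] turns the supergradient
   inequality at [k j] into the strict bound on [alpha i + beta j]. *)
exists (fun i => y (k i)), (perm t_inj), (fun i => trapezoid x y (k i)),
  (fun j => x (k j) * y (k j) - trapezoid x y (k j)); split.
- by move=> i; rewrite permE tE.
- move=> i j; rewrite -!xk => ltx; apply: ydec; rewrite kn andbT ltnNge.
  apply/negP; rewrite leq_eqVlt => /predU1P[kE|lt_k]; first by rewrite kE ltxx in ltx.
  by have := xinc (k j) (k i); rewrite lt_k kn ltNge (ltW ltx) => /(_ isT).
- by move=> i; rewrite addrC subrK xk.
- move=> i j ij; have kij : k i != k j by apply: contra ij => /eqP/k_inj->.
  have := trapezoid_strictly_concave xinc ydec (kn i) (kn j) kij.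
  rewrite -!xk; lra.
Qed.

(** As [tau] is a bijection, [f] and [g] have equally many values below any threshold, and the
    common order makes the thresholds [f i] and [g i] give equal counts. If they differed, the
    smaller one, itself a value of [f], would separate the counts. *)
Lemma eq_comonotone (I : finType) (f g : I -> R) (tau : I -> I) : injective tau ->
  (forall i, g i = f (tau i)) -> (forall i j, (f i < f j) = (g i < g j)) -> f =1 g.
Proof.
move=> tau_inj gE fg i.
have cardE t : #|[pred j | g j < t]| = #|[pred j | f j < t]|.
  rewrite -(card_image tau_inj); apply: eq_card => j.
  by rewrite -[j](f_invF tau_inj) (fintype.mem_image tau_inj) !inE gE.
have card_lt t t' l : t <= f l < t' ->
    (#|[pred j | f j < t]%R| < #|[pred j | f j < t']%R|)%N.
  case/andP=> tl lt'; apply: proper_card; apply/properP; split.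
    by apply/fintype.subsetP => j; rewrite !inE => /lt_le_trans; apply;
      rewrite ltW ?(le_lt_trans tl).
  by exists l; rewrite !inE // -leNgt.
have rankE : #|[pred j | f j < f i]| = #|[pred j | f j < g i]|.
  by rewrite -(cardE (g i)); apply: eq_card => j; rewrite !inE fg.
apply/eqP; rewrite eq_le; apply/andP; split; rewrite leNgt; apply/negP => lt_fg.
  have := @card_lt (g i) (f i) (tau i); rewrite -gE lexx lt_fg => /(_ isT).
  by rewrite rankE ltnn.
have := @card_lt (f i) (g i) i; rewrite lexx lt_fg => /(_ isT).
by rewrite rankE ltnn.
Qed.

End Rearrangement.

(** * Bloch representation *)

Section HermitianMatrices.
Variables (C : numClosedFieldType) (n : nat).
Implicit Types A B : 'M[C]_n.
Local Open Scope sesquilinear_scope.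

Lemma hermsymmxP A : reflect (A ^t* = A) (A \is hermsymmx).
Proof.
by apply: (iffP (is_hermitianmxP _ _ _)); rewrite expr0 scale1r => /esym.
Qed.

Lemma hermsymmx_conj A i j : A \is hermsymmx -> (A i j)^* = A j i.
Proof. by move=> /hermsymmxP AE; rewrite -[in RHS]AE !mxE. Qed.

Lemma hermsymmx_diag_real A k : A \is hermsymmx -> A k k \is Num.real.
Proof. by move=> Ah; apply/CrealP; rewrite hermsymmx_conj. Qed.

Lemma trmxC_mul A B : (A *m B) ^t* = B ^t* *m A ^t*.
Proof. by rewrite trmx_mul map_mxM. Qed.

Lemma mxtrace_trmxC A : \tr (A ^t*) = (\tr A)^*.
Proof. by rewrite trace_map_mx mxtrace_tr. Qed.

Lemma mxtrace_hermsymmx_mul_real A B :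
  A \is hermsymmx -> B \is hermsymmx -> \tr (A *m B) \is Num.real.
Proof.
move=> /hermsymmxP Ah /hermsymmxP Bh; apply/CrealP.
by rewrite -mxtrace_trmxC trmxC_mul Ah Bh mxtrace_mulC.
Qed.

Lemma mxtrace_i_commutator_real A B D :
    A \is hermsymmx -> B \is hermsymmx -> D \is hermsymmx ->
  \tr ('i *: A *m (B *m D - D *m B)) \is Num.real.
Proof.
move=> /hermsymmxP Ah /hermsymmxP Bh /hermsymmxP Dh; apply/CrealP.
rewrite -mxtrace_trmxC trmxC_mul linearZ /= map_mxZ /= conjCi Ah linearB /= map_mxB.
rewrite !trmxC_mul Bh Dh mxtrace_mulC -!scalemxAl !mxtraceZ mulNr -mulrN.
by rewrite -raddfN -mulmxN opprB.
Qed.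

Lemma hermsymmx_decomposition A : exists B D,
  [/\ B \is hermsymmx, D \is hermsymmx & A = B + 'i *: D].
Proof.
exists (2^-1 *: (A + A ^t*)), (2^-1 *: (- 'i *: (A - A ^t*))).
have r2 : (2^-1 : C)^* = 2^-1 by rewrite fmorphV rmorph_nat.
split.
- apply/hermsymmxP; rewrite linearZ /= map_mxZ /= r2 linearD /= map_mxD.
  by rewrite trmxCK addrC.
- apply/hermsymmxP; rewrite !linearZ /= !map_mxZ /= r2 linearB /= map_mxB.
  by rewrite trmxCK rmorphN /= conjCi opprK;
    rewrite -[A ^t* - A]opprB scalerN scaleNr scalerN !scalerA mulrC.
- rewrite !scalerA mulrAC mulrN -expr2 sqrCi opprK mul1r -scalerDr.
  by rewrite addrACA subrr addr0 -mulr2n -[A *+ 2]scaler_nat scalerA mulVf ?scale1r ?pnatr_eq0.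
Qed.

End HermitianMatrices.

(** * Complexified Bloch coordinates and eigenmatrices *)

Section ComplexBloch.
Variables (R : realType) (n : nat) (xi : 'I_(n ^ 2).-1.+1 -> 'M[R[i]]_n).
Local Notation C := R[i].
Hypothesis n_gt0 : (0 < n)%N.
Hypothesis xiP : bloch_basis xi.

(** The complex linear extension of [bloch]: no real part is taken, because eigenvectors correspond
    to matrices that need not be Hermitian. *)
Definition complex_bloch (A : 'M[C]_n) : 'rV[C]_(n ^ 2).-1 :=
  \row_m \tr (A *m bloch_xi xi m).

Definition complex_traceless_mx (v : 'rV[C]_(n ^ 2).-1) : 'M[C]_n :=
  \sum_m v 0 m *: bloch_xi xi m.

Let xi_herm m : bloch_xi xi m \is hermsymmx.
Proof. by case: xiP => xi_h _ _ _; exact: xi_h. Qed.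

Let xi_ortho m m' : \tr (bloch_xi xi m *m bloch_xi xi m') = (m == m')%:R.
Proof.
case: xiP => _ ortho _ _; by rewrite ortho -!val_eqE.
Qed.

Lemma complex_bloch_basis_sum (A : 'M[C]_n) : A = \sum_m \tr (A *m xi m) *: xi m.
Proof.
case: xiP => _ ortho span _.
have [B [D [/span[b BE] /span[d DE] AE]]] := hermsymmx_decomposition A.
have [g gE] : exists g : _ -> C, A = \sum_m g m *: xi m.
  exists (fun m => (b m)%:C%C + 'i * (d m)%:C%C); rewrite AE BE DE scaler_sumr.
  by rewrite -big_split /=; apply: eq_bigr => m _; rewrite scalerA -scalerDl.
rewrite [LHS]gE; apply: eq_bigr => m _; congr (_ *: _).
rewrite gE mulmx_suml raddf_sum (bigD1 m) //= big1 => [|m' ne].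
  by rewrite -scalemxAl mxtraceZ ortho eqxx mulr1 addr0.
by rewrite -scalemxAl mxtraceZ ortho (negbTE ne) mulr0.
Qed.

Lemma complex_blochK (A : 'M[C]_n) :
  complex_traceless_mx (complex_bloch A) = A - (\tr A / n%:R)%:M.
Proof.
apply/eqP; rewrite -subr_eq opprK eq_sym {1}[A]complex_bloch_basis_sum big_ord_recr /=.
apply/eqP; congr (_ + _); last first.
  case: xiP => _ _ _ ->; rewrite mul_mx_scalar mxtraceZ scale_scalar_mx.
  rewrite mulrAC mulrC -rmorphM /= -invfM -expr2 sqr_sqrtr ?ler0n // fmorphV.
  by rewrite rmorph_nat.
by apply: eq_bigr => m _; rewrite mxE.
Qed.

Lemma complex_traceless_mxK v : complex_bloch (complex_traceless_mx v) = v.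
Proof.
apply/rowP => m; rewrite mxE mulmx_suml raddf_sum (bigD1 m) //= big1 => [|m' ne].
  by rewrite -scalemxAl mxtraceZ xi_ortho eqxx mulr1 addr0.
by rewrite -scalemxAl mxtraceZ xi_ortho (negbTE ne) mulr0.
Qed.

Lemma mxtrace_complex_traceless_mx v : \tr (complex_traceless_mx v) = 0.
Proof.
have := congr1 (fun A => \tr A) (complex_blochK (complex_traceless_mx v)).
rewrite complex_traceless_mxK raddfB /= mxtrace_scalar -(mulr_natr (_ / _)) mulfVK ?subrr //.
by rewrite pnatr_eq0 -lt0n.
Qed.

(** Real combinations of Hermitian matrices have real diagonals, so a complex diagonal entry
    vanishes exactly when the contributions of the real and imaginary parts of [v] both do. *)
Lemma complex_traceless_mx_diag v :
  S_T xi (map_mx (@complex.Re R) v) /\ S_T xi (map_mx (@complex.Im R) v) <->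
  forall k, complex_traceless_mx v k k = 0.
Proof.
have real_diag s k : exists r : R, traceless_mx xi s k k = r%:C%C.
  exists (complex.Re (traceless_mx xi s k k)); rewrite RRe_real //.
  rewrite summxE rpred_sum // => m _; rewrite mxE rpredM ?hermsymmx_diag_real //.
  by apply/complex_realP; exists (s 0 m).
have vE : complex_traceless_mx v =
    traceless_mx xi (map_mx (@complex.Re R) v) +
    'i%C *: traceless_mx xi (map_mx (@complex.Im R) v).
  rewrite scaler_sumr -big_split /=; apply: eq_bigr => m _.
  by rewrite scalerA -scalerDl !mxE -complexE.
split=> [[vRe vIm] k|v0]; first by rewrite vE mxE [X in _ + X]mxE vRe vIm mulr0 addr0.
suff h k : traceless_mx xi (map_mx (@complex.Re R) v) k k = 0 /\
    traceless_mx xi (map_mx (@complex.Im R) v) k k = 0.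
  by split=> k; have [] := h k.
have := v0 k; rewrite vE mxE [X in _ + X]mxE.
have [r ->] := real_diag (map_mx (@complex.Re R) v) k.
have [t ->] := real_diag (map_mx (@complex.Im R) v) k.
move=> h; have := congr1 (@complex.Re R) h; have := congr1 (@complex.Im R) h.
by rewrite /= mul1r !mul0r !mulr0 subrr !add0r addr0 => -> ->.
Qed.

Lemma complex_bloch_inj A B : \tr A = \tr B -> complex_bloch A = complex_bloch B -> A = B.
Proof.
move=> trAB /(congr1 complex_traceless_mx); rewrite !complex_blochK trAB.
exact: addIr.
Qed.

Let complex_blochD A B : complex_bloch (A + B) = complex_bloch A + complex_bloch B.
Proof. by apply/rowP => m; rewrite !mxE mulmxDl raddfD. Qed.

Let complex_blochZ (c : C) A : complex_bloch (c *: A) = c *: complex_bloch A.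
Proof. by apply/rowP => m; rewrite !mxE -scalemxAl mxtraceZ. Qed.

Lemma mxtrace_commutator (A B : 'M[C]_n) : \tr (commutator A B) = 0.
Proof. by rewrite /commutator raddfB /= mxtrace_mulC subrr. Qed.

(** Parseval's identity; the coordinate along the identity is absent, and its contribution is
    proportional to [\tr A]. *)
Lemma complex_bloch_dot (A B : 'M[C]_n) : \tr A = 0 ->
  (complex_bloch A *m (complex_bloch B)^T) 0 0 = \tr (A *m B).
Proof.
move=> trA; rewrite mxE; have := complex_blochK A; rewrite trA mul0r raddf0 subr0.
move=> {2}<-; rewrite mulmx_suml raddf_sum; apply: eq_bigr => m _ /=.
by rewrite -scalemxAl mxtraceZ !mxE [\tr (B *m _)]mxtrace_mulC.
Qed.

Lemma complex_bloch_hermsymmx A : A \is hermsymmx ->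
  complex_bloch A = map_mx (real_complex R) (bloch xi A).
Proof.
move=> Ah; apply/rowP => m; rewrite !mxE /hs RRe_real //.
exact: mxtrace_hermsymmx_mul_real.
Qed.

(** In coordinates, [bloch_A xi H] is the map [A |-> -i[H, A]]; the scalar part of [A] is lost in
    the coordinates but commutes with [H]. *)
Lemma complex_bloch_commutator H A : H \is hermsymmx ->
  complex_bloch A *m (map_mx (real_complex R) (bloch_A xi H))^T =
  complex_bloch (- 'i%C *: commutator H A).
Proof.
move=> Hh; apply/rowP => m.
have -> : commutator H A = commutator H (complex_traceless_mx (complex_bloch A)).
  rewrite complex_blochK /commutator mulmxBl mulmxBr mul_scalar_mx mul_mx_scalar.
  by rewrite opprB addrA subrK.
rewrite mxE [RHS]mxE -scalemxAl mxtraceZ trace_commutator.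
rewrite /commutator mulmx_suml mulmx_sumr -sumrB mulmx_sumr raddf_sum mulr_sumr.
apply: eq_bigr => m' _ /=.
have -> : (map_mx (real_complex R) (bloch_A xi H))^T m' m =
    \tr ('i%C *: H *m commutator (bloch_xi xi m) (bloch_xi xi m')).
  by rewrite !mxE RRe_real // mxtrace_i_commutator_real.
have -> (c : C) (X Y : 'M[C]_n) : c *: X *m Y - Y *m (c *: X) = c *: (X *m Y - Y *m X).
  by rewrite -scalemxAl -scalemxAr scalerBr.
rewrite -scalemxAr mxtraceZ mulrCA; congr (_ * _).
by rewrite -scalemxAl mxtraceZ mulNr -mulrN -raddfN -mulmxN opprB.
Qed.

(** Carries the eigenvalue problem from Bloch vectors back to matrices: the rank one term becomes a
    trace functional of [X] times [-i[H1, rho]]. Both sides of the matrix equation are traceless, so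
    their coordinates determine them. *)
Lemma T_eigenvalueP (a : 'I_n -> R) H1 rhod rho z :
    H1 \is hermsymmx -> H0 a \is hermsymmx -> density rhod -> density rho ->
    commutator rho rhod = 0 ->
  T_eigenvalue xi a H1 rhod rho z <->
  exists X : 'M[C]_n, [/\ X != 0, forall k, X k k = 0 &
    - 'i%C *: commutator (H0 a) X +
      \tr (- 'i%C *: commutator H1 X *m rhod) *: (- 'i%C *: commutator H1 rho) = z *: X].
Proof.
move=> H1h H0h rhodP rhoP rho_comm.
have [[rhod_herm _] _] := rhodP; have [[rho_herm _] _] := rhoP.
have linE A : complex_bloch A *m map_mx (real_complex R)
      (linearization xi a H1 rhod (bloch xi rho)) =
    complex_bloch (- 'i%C *: commutator (H0 a) A +
      \tr (- 'i%C *: commutator H1 A *m rhod) *: (- 'i%C *: commutator H1 rho)).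
  rewrite linearization_commuting //.
  set A0 := bloch_A xi (H0 a); set A1 := bloch_A xi H1.
  have -> : map_mx (real_complex R) (A0 + A1 *m (bloch xi rho)^T *m bloch xi rhod *m A1)^T =
      (map_mx (real_complex R) A0)^T +
      (map_mx (real_complex R) A1)^T *m (map_mx (real_complex R) (bloch xi rhod))^T *m
      map_mx (real_complex R) (bloch xi rho) *m (map_mx (real_complex R) A1)^T.
    by rewrite linearD /= map_mxD !trmx_mul trmxK !map_mxM !map_trmx !mulmxA.
  rewrite mulmxDr !mulmxA !complex_bloch_commutator // -!complex_bloch_hermsymmx //.
  rewrite complex_blochD [X in _ = _ + X]complex_blochZ; congr (_ + _).
  rewrite [X in X *m _ *m _]mx11_scalar complex_bloch_dot; last first.
    by rewrite mxtraceZ mxtrace_commutator mulr0.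
  by rewrite mul_scalar_mx -scalemxAl complex_bloch_commutator.
split=> [[v [v0 vRe vIm vE]]|[X [X0 Xd XE]]].
  exists (complex_traceless_mx v); split.
  - by apply: contra v0 => /eqP vz; rewrite -[v]complex_traceless_mxK vz;
    apply/eqP/rowP => m; rewrite !mxE mul0mx raddf0.
  - exact/complex_traceless_mx_diag.
  - apply: complex_bloch_inj.
      rewrite mxtraceD !mxtraceZ !mxtrace_commutator mxtrace_complex_traceless_mx.
      by rewrite !mulr0 addr0.
    by rewrite -linE complex_blochZ complex_traceless_mxK.
have trX : \tr X = 0 by rewrite /mxtrace big1.
have XK : complex_traceless_mx (complex_bloch X) = X.
  by rewrite complex_blochK trX mul0r raddf0 subr0.
exists (complex_bloch X).
have [|sRe sIm] := (complex_traceless_mx_diag (complex_bloch X)).2; first by rewrite XK.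
split => //; last by rewrite linE XE complex_blochZ.
by apply: contra X0 => /eqP Xz; rewrite -XK Xz /complex_traceless_mx big1 // => m _;
  rewrite mxE scale0r.
Qed.

End ComplexBloch.

(** * Diagonal states *)

Section DiagonalStates.
Variables (R : realType) (n : nat).
Local Notation C := R[i].
Local Open Scope sesquilinear_scope.
Implicit Types (r d a : 'I_n -> R).

(** From here on [H0] denotes any real diagonal matrix, states as well as the free Hamiltonian. *)
Lemma commutator_diag r (A : 'M[C]_n) i j :
  commutator (H0 r) A i j = ((r i)%:C%C - (r j)%:C%C) * A i j.
Proof.
by rewrite /commutator /H0 mul_diag_mx mul_mx_diag !mxE mulrBl [A i j * _]mulrC.
Qed.

Lemma commutatorC (A B : 'M[C]_n) : commutator A B = - commutator B A.
Proof. by rewrite /commutator opprB. Qed.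

Lemma commutator_diag_diag r d : commutator (H0 r) (H0 d) = 0.
Proof. by rewrite /commutator diag_mxC subrr. Qed.

Lemma H0_hermsymmx r : H0 r \is hermsymmx.
Proof.
apply/hermsymmxP; rewrite tr_diag_mx map_diag_mx; congr diag_mx.
by apply/rowP => k; rewrite !mxE; apply/CrealP/complex_realP; exists (r k).
Qed.

Lemma H0_entry r i j : H0 r i j = (r i)%:C%C *+ (i == j).
Proof. by rewrite !mxE. Qed.

Lemma commuting_diag a (A : 'M[C]_n) : injective a -> A \is hermsymmx ->
  commutator (H0 a) A = 0 -> A = H0 (fun k => complex.Re (A k k)).
Proof.
move=> a_inj Ah /matrixP A0; apply/matrixP => i j; rewrite H0_entry.
have [<-|ij] := eqVneq; first by rewrite mulr1n RRe_real // hermsymmx_diag_real.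
have /eqP := A0 i j; rewrite commutator_diag mxE mulf_eq0 mulr0n.
by rewrite subr_eq0 (inj_eq (@complexI R)) (inj_eq a_inj) (negbTE ij) => /eqP.
Qed.

Lemma char_poly_H0 r : char_poly (H0 r) = \prod_k ('X - ((r k)%:C%C)%:P).
Proof.
rewrite char_poly_trig ?diag_mx_is_trig //; apply: eq_bigr => k _.
by rewrite H0_entry eqxx.
Qed.

Lemma H0_inj r d : H0 r = H0 d -> r =1 d.
Proof.
by move=> /matrixP rd k; have := rd k k; rewrite !H0_entry eqxx => /complexI.
Qed.

(** The [n] distinct eigenvalues all occur among the [n] diagonal entries, which leaves no room for
    a repetition. *)
Lemma generic_H0 r : generic (H0 r) -> injective r.
Proof.
case=> l l_uniq l_ev.
have sub : {subset l <= [seq (r k)%:C%C | k <- enum 'I_n]}.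
  move=> z /l_ev; rewrite eigenvalue_root_char char_poly_H0.
  by rewrite -[\prod_k _](big_map (fun k => (r k)%:C%C) xpredT (fun z => 'X - z%:P))
    root_prod_XsubC /index_enum -enumT.
have u : uniq [seq (r k)%:C%C | k <- enum 'I_n].
  by apply: leq_size_uniq l_uniq sub _; rewrite size_map size_enum_ord size_tuple.
by move=> i j rij; apply: (injectiveP _ u); rewrite rij.
Qed.

Lemma prod_XsubC_reindex (F : fieldType) (e d : 'I_n -> F) : injective d ->
    \prod_k ('X - (e k)%:P) = \prod_k ('X - (d k)%:P) ->
  exists2 tau : 'I_n -> 'I_n, injective tau & forall k, e k = d (tau k).
Proof.
move=> d_inj.
have E (f : 'I_n -> F) : \prod_k ('X - (f k)%:P) = \prod_(z <- [seq f k | k <- enum 'I_n])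
  ('X - z%:P).
  by rewrite big_map /index_enum -enumT.
rewrite !E => /prod_XsubC_eq pe.
have u : uniq [seq e k | k <- enum 'I_n].
  by rewrite (perm_uniq pe) map_inj_uniq ?enum_uniq.
have e_inj : injective e by apply/injectiveP.
have /fin_all_exists[tau tauE] k : exists j, e k = d j.
  have : e k \in [seq d k | k <- enum 'I_n].
    by rewrite -(perm_mem pe) map_f // mem_enum.
  by case/mapP => j _ ->; exists j.
by exists tau => // i j tij; apply: e_inj; rewrite !tauE tij.
Qed.

Lemma density_H0_ge0 r : density (H0 r) -> forall k, 0 <= r k.
Proof.
case=> -[_ psd] _ k; have := psd (delta_mx k 0).
rewrite trmx_delta map_delta_mx -rowE -colE !mxE eqxx.
by rewrite lecE /= eqxx.
Qed.

Lemma isospectral_H0 d (tau : 'I_n -> 'I_n) : injective tau ->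
  density (H0 d) -> isospectral (H0 d) (H0 (d \o tau)).
Proof.
move=> tau_inj dd; have d0 := density_H0_ge0 dd; case: dd => _ tr1.
have tau_bij : {on [pred i | xpredT i], bijective tau} by apply/onW_bij/injF_bij.
split; last first.
  rewrite !char_poly_H0 [RHS](reindex tau) //.
split; first split; first exact: H0_hermsymmx.
  move=> v; rewrite /H0 mul_mx_diag mxE sumr_ge0 // => k _.
  by rewrite !mxE mulrAC mulr_ge0 ?ler0c ?d0 // mulrC mul_conjC_ge0.
rewrite -tr1 /H0 !mxtrace_diag [RHS](reindex tau) //.
by apply: eq_bigr => k _; rewrite !mxE.
Qed.

(** Pairing the stationarity equation with [H0 d] removes the [H0 a] term and leaves [f *
    \tr([H1, rho] H0 d) = 0]. The feedback [f] is itself computed from this trace, so it vanishes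
    either way. *)
Lemma stationary_feedback0 a H1 d rho :
  stationary_state a H1 (H0 d) rho -> commutator (H0 a) rho = 0.
Proof.
case=> _; rewrite /vfield; set f := feedback _ _ _ => /eqP;
  rewrite scaler_eq0 oppr_eq0 => /orP[|/eqP c0].
  by rewrite eq_complex /= oner_eq0 andbF.
have cD (A B D : 'M[C]_n) : commutator (A + B) D = commutator A D + commutator B D.
  by rewrite /commutator mulmxDl mulmxDr opprD addrACA.
suff f0 : f = 0 by move: c0; rewrite f0 scale0r addr0.
apply/eqP/negP => /negP f0.
have : \tr (commutator (H0 a + f%:C%C *: H1) rho *m H0 d) = 0.
  by rewrite c0 mul0mx raddf0.
rewrite cD commutatorZl mulmxDl mxtraceD -scalemxAl mxtraceZ.
have -> : \tr (commutator (H0 a) rho *m H0 d) = 0.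
  rewrite trace_commutator /commutator mulmxBr raddfB /= mulmxA mxtrace_mulC.
  by rewrite !mulmxA (diag_mxC _ _) subrr.
rewrite add0r => /eqP; rewrite mulf_eq0 => /orP[/eqP/complexI/eqP|/eqP t0].
  by rewrite (negbTE f0).
by move: f0; rewrite /f /feedback /hs commutatorZl -scalemxAl mxtraceZ t0 mulr0 /= eqxx.
Qed.

End DiagonalStates.

(** * The linearization at a diagonal state as a rank one perturbation *)

Section Linearization.
Variables (R : realType) (n : nat) (xi : 'I_(n ^ 2).-1.+1 -> 'M[R[i]]_n).
Variables (a d r : 'I_n -> R) (H1 : 'M[R[i]]_n).
Local Notation C := R[i].
Hypothesis n_gt0 : (0 < n)%N.
Hypothesis xiP : bloch_basis xi.
Hypothesis H1_herm : H1 \is hermsymmx.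
Hypothesis H_ideal : ideal a H1.
Hypothesis d_density : density (H0 d).
Hypothesis r_density : density (H0 r).
Hypothesis d_inj : injective d.
Hypothesis r_inj : injective r.

(** A finite type of indices for the entries of a matrix with zero diagonal, so that the secular
    analysis applies with [J := off_diag]. *)
Definition off_diag := {p : 'I_n * 'I_n | p \in [pred p | p.1 != p.2]}.
Implicit Types j : off_diag.

Lemma off_diagP j : (val j).1 != (val j).2.
Proof. exact: (valP j). Qed.

Lemma sum_off_diag (F : 'I_n -> 'I_n -> C) : (forall k, F k k = 0) ->
  \sum_k \sum_l F k l = \sum_(j : off_diag) F (val j).1 (val j).2.
Proof.
move=> F0; rewrite pair_bigA /= (bigID (mem [pred p : 'I_n * 'I_n | p.1 != p.2])) /=.
rewrite [X in _ + X]big1 ?addr0 => [|[k l] /=]; last first.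
  by rewrite inE negbK => /eqP /= ->.
by rewrite (big_sub [pred p : 'I_n * 'I_n | p.1 != p.2] (fun p => F p.1 p.2)).
Qed.

Definition frequency j : R := omega a (val j).1 (val j).2.

Definition weight j : R :=
  - ((complex.Re (H1 (val j).1 (val j).2) ^+ 2 +
      complex.Im (H1 (val j).1 (val j).2) ^+ 2) *
     ((r (val j).2 - r (val j).1) * (d (val j).2 - d (val j).1))).

(** The off-diagonal entries of [-i[H1, H0 r]]. *)
Definition control_column j : C :=
  - 'i%C * (H1 (val j).1 (val j).2 * ((r (val j).2)%:C%C - (r (val j).1)%:C%C)).

(** The coefficients of the linear form [X |-> \tr(-i[H1, X] H0 d)]; the trace pairs the entry
    [(k, l)] of [X] with the transposed entry of [H1]. *)
Definition feedback_row j : C :=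
  - 'i%C * (H1 (val j).2 (val j).1 * ((d (val j).2)%:C%C - (d (val j).1)%:C%C)).

Let H1_sqr_gt0 j :
  0 < complex.Re (H1 (val j).1 (val j).2) ^+ 2 +
      complex.Im (H1 (val j).1 (val j).2) ^+ 2.
Proof. by apply: complex_sqr_gt0; case: H_ideal => _; apply; exact: off_diagP. Qed.

Lemma frequency_inj : injective frequency.
Proof.
move=> j l; case: H_ideal => h _ jl; apply: val_inj; have := off_diagP j; have := off_diagP l.
move: jl; rewrite /frequency; case: (val j) (val l) => [k1 k2] [l1 l2] /= kl lne kne.
exact: h.
Qed.

Lemma weight_neq0 j : weight j != 0.
Proof.
rewrite /weight oppr_eq0 mulf_eq0 (gt_eqF (H1_sqr_gt0 j)) mulf_eq0 !subr_eq0.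
by rewrite (inj_eq r_inj) (inj_eq d_inj) orbb eq_sym off_diagP.
Qed.

(** Hermiticity turns the product of the two entries of [H1] into a squared modulus, and the square
    of [-i] supplies the minus sign. *)
Lemma control_column_feedback_row j :
  control_column j * feedback_row j = (weight j)%:C%C.
Proof.
rewrite /control_column /feedback_row -(hermsymmx_conj (val j).1 (val j).2) //.
rewrite mulrACA mulrNN -expr2 sqr_i mulrACA -normCK -add_Re2_Im2.
by rewrite -!rmorphB -!rmorphM mulN1r -rmorphN.
Qed.

Lemma mxtrace_feedback (X : 'M[C]_n) : (forall k, X k k = 0) ->
  \tr (- 'i%C *: commutator H1 X *m H0 d) =
  \sum_(j : off_diag) feedback_row j * X (val j).1 (val j).2.
Proof.
move=> X0; rewrite -scalemxAl mxtraceZ trace_commutator commutatorC.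
transitivity (\sum_k \sum_l - 'i%C * (H1 l k * ((d l)%:C%C - (d k)%:C%C)) * X k l); last first.
  by rewrite sum_off_diag // => k; rewrite X0 mulr0.
rewrite mulmxN raddfN /= /mxtrace mulrN -mulNr opprK mulr_sumr exchange_big /=.
apply: eq_bigr => l _; rewrite mxE mulr_sumr; apply: eq_bigr => k _.
rewrite commutator_diag; ring.
Qed.

Lemma T_eigenvalue_rank_one z :
  T_eigenvalue xi a H1 (H0 d) (H0 r) z <->
  rank_one_eigenvalue frequency control_column feedback_row z.
Proof.
rewrite T_eigenvalueP ?H0_hermsymmx ?commutator_diag_diag //.
have entry (X : 'M[C]_n) g k l :
    (- 'i%C *: commutator (H0 a) X + g *: (- 'i%C *: commutator H1 (H0 r))) k l =
    'i%C * (omega a k l)%:C%C * X k l +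
    g * (- 'i%C * (H1 k l * ((r l)%:C%C - (r k)%:C%C))).
  rewrite [commutator H1 _]commutatorC mxE [X in X + _]mxE [X in _ + X]mxE.
  rewrite [X in _ + _ * X]mxE [X in _ + _ * (_ * X)]mxE !commutator_diag /omega rmorphB /=.
  ring.
split=> [[X [X0 Xd /matrixP XE]]|[f [j fj] fE]].
  exists (fun j => X (val j).1 (val j).2).
    have [/existsP[k /existsP[l Xkl]]|/existsPn X00] := boolP [exists k, exists l, X k l != 0].
      have kl : (k, l) \in [pred p : 'I_n * 'I_n | p.1 != p.2].
        by rewrite inE /=; apply: contraNneq Xkl => ->; rewrite Xd.
      by exists (Sub (k, l) kl).
    case/eqP: X0; apply/matrixP => k l; rewrite mxE; apply/eqP.
    by have /existsPn/(_ l) := X00 k; rewrite negbK.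
  move=> j; have := XE (val j).1 (val j).2.
  by rewrite entry mxtrace_feedback // [in RHS]mxE.
(* Extends [f] by zero to the diagonal: [insub] fails exactly when [k = l]. *)
pose X : 'M[C]_n := \matrix_(k, l)
  if insub (k, l) is Some j then f j else 0.
have Xf j' : X (val j').1 (val j').2 = f j' by rewrite mxE -surjective_pairing valK.
have Xd k : X k k = 0 by rewrite mxE insubF // inE /= eqxx.
exists X; split=> //.
  by apply: contra fj => /eqP X0; rewrite -Xf X0 mxE.
apply/matrixP => k l; rewrite entry mxtrace_feedback // [RHS]mxE.
have [<-|kl] := eqVneq k l; first by rewrite Xd subrr !mulr0 addr0.
have kl' : (k, l) \in [pred p : 'I_n * 'I_n | p.1 != p.2] by [].
have := fE (Sub (k, l) kl'); rewrite -!Xf SubK /= => <-.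
by congr (_ + _ * _); apply: eq_bigr => j' _; rewrite Xf.
Qed.

Lemma hyperbolic_diag : hyperbolic xi a H1 (H0 d) (H0 r).
Proof.
move=> z /T_eigenvalue_rank_one.
exact: (rank_one_hyperbolic frequency_inj weight_neq0 control_column_feedback_row).
Qed.

Lemma sink_diag :
  (forall k l, k != l -> 0 < (r l - r k) * (d l - d k)) ->
  sink xi a H1 (H0 d) (H0 r).
Proof.
move=> rd z /T_eigenvalue_rank_one.
apply: (rank_one_stable frequency_inj weight_neq0 control_column_feedback_row).
by move=> j; rewrite oppr_lt0 mulr_gt0 ?rd ?off_diagP.
Qed.

Lemma source_diag :
  (forall k l, k != l -> (r l - r k) * (d l - d k) < 0) ->
  source xi a H1 (H0 d) (H0 r).
Proof.
move=> rd z /T_eigenvalue_rank_one.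
apply: (rank_one_unstable frequency_inj weight_neq0 control_column_feedback_row).
by move=> j; rewrite oppr_gt0 pmulr_rlt0 ?rd ?off_diagP.
Qed.

Lemma exists_stable_diag k l : 0 < (r l - r k) * (d l - d k) ->
  exists2 z, T_eigenvalue xi a H1 (H0 d) (H0 r) z & complex.Re z < 0.
Proof.
move=> rd; have kl : (k, l) \in [pred p : 'I_n * 'I_n | p.1 != p.2].
  by rewrite inE /=; apply: contraTneq rd => ->; rewrite !subrr mul0r ltxx.
have : weight (Sub (k, l) kl) < 0 by rewrite oppr_lt0 mulr_gt0.
move=> /(rank_one_exists_stable frequency_inj weight_neq0 control_column_feedback_row).
by case=> z /T_eigenvalue_rank_one; exists z.
Qed.

Lemma exists_unstable_diag k l : (r l - r k) * (d l - d k) < 0 ->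
  exists2 z, T_eigenvalue xi a H1 (H0 d) (H0 r) z & 0 < complex.Re z.
Proof.
move=> rd; have kl : (k, l) \in [pred p : 'I_n * 'I_n | p.1 != p.2].
  by rewrite inE /=; apply: contraTneq rd => ->; rewrite !subrr mul0r ltxx.
have : 0 < weight (Sub (k, l) kl) by rewrite oppr_gt0 pmulr_rlt0.
move=> /(rank_one_exists_unstable frequency_inj weight_neq0 control_column_feedback_row).
by case=> z /T_eigenvalue_rank_one; exists z.
Qed.

End Linearization.

(** * Global maximum of the Lyapunov function *)

Section GlobalMaximum.
Variables (R : realType) (n : nat).
Local Notation C := R[i].
Local Open Scope sesquilinear_scope.
Implicit Types (d e : 'I_n -> R) (sigma P : 'M[C]_n).

Lemma char_poly_similar sigma P (D : 'M[C]_n) : P \in unitmx ->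
  sigma = invmx P *m D *m P -> char_poly sigma = char_poly D.
Proof.
move=> Pu ->; rewrite /char_poly /char_poly_mx.
pose Q := map_mx polyC P; pose Q' := map_mx polyC (invmx P).
have QQ : Q' *m Q = 1%:M by rewrite -map_mxM mulVmx // map_mx1.
have -> : 'X%:M - map_mx polyC (invmx P *m D *m P) = Q' *m ('X%:M - map_mx polyC D) *m Q.
  rewrite mulmxBr mulmxBl !map_mxM; congr (_ - _).
  by rewrite mul_mx_scalar -scalemxAl QQ scale_scalar_mx mulr1.
by rewrite !det_mulmx mulrAC -det_mulmx QQ det1 mul1r.
Qed.

(** The spectral theorem diagonalizes [sigma]; equality of characteristic polynomials makes its
    eigenvalues a rearrangement of [d]. *)
Lemma isospectral_unitary d sigma : injective d -> isospectral (H0 d) sigma ->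
  exists (P : 'M[C]_n) (tau : 'I_n -> 'I_n),
    [/\ P \is unitarymx, injective tau & sigma = P ^t* *m H0 (d \o tau) *m P].
Proof.
move=> d_inj [[[sh _] _] cp].
have /orthomx_spectralP sE := hermitian_normalmx sh.
set P := spectralmx sigma in sE; set sp := spectral_diag sigma in sE.
have Pu : P \is unitarymx by exact: spectral_unitarymx.
have spR k : ((complex.Re (sp 0 k))%:C%C = sp 0 k).
  by rewrite RRe_real //; have /mxOverP := hermitian_spectral_diag_real sh.
have spE : diag_mx sp = H0 (fun k => complex.Re (sp 0 k)).
  by congr diag_mx; apply/rowP => k; rewrite mxE spR.
rewrite spE in sE.
have := char_poly_similar (unitarymx_unit Pu) sE; rewrite cp !char_poly_H0 => /esym.
move/prod_XsubC_reindex => [|tau tau_inj tauE].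
  by move=> i j /complexI/d_inj.
exists P, tau; split => //; rewrite {1}sE invmx_unitary //; congr (_ *m _ *m _).
by congr diag_mx; apply/rowP => k; rewrite !mxE tauE.
Qed.

Lemma mxtrace_sqr_isospectral d sigma : injective d -> isospectral (H0 d) sigma ->
  \tr (sigma *m sigma) = \tr (H0 d *m H0 d).
Proof.
move=> d_inj /(isospectral_unitary d_inj)[P [tau [Pu tau_inj ->]]].
rewrite !mulmxA mulmxtVK // -mulmxA mxtrace_mulC mulmxA mulmxtVK //.
rewrite /H0 !mulmx_diag !mxtrace_diag [RHS](reindex tau); last first.
  exact/onW_bij/injF_bij.
by apply: eq_bigr => k _; rewrite !mxE.
Qed.

Lemma lyapunov_isospectral d sigma : injective d -> isospectral (H0 d) sigma ->
  lyapunov (H0 d) sigma =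
  complex.Re (\tr (H0 d *m H0 d)) - hs sigma (H0 d).
Proof.
move=> d_inj si; rewrite /lyapunov /hs mulmxBl !mulmxBr !raddfB /=.
rewrite (mxtrace_sqr_isospectral d_inj si) [\tr (H0 d *m sigma)]mxtrace_mulC.
case: (\tr (H0 d *m H0 d)) (\tr (sigma *m H0 d)) => [x ?] [y ?] /=.
by field.
Qed.

Lemma hs_H0 e d : hs (H0 e) (H0 d) = \sum_k d k * e k.
Proof.
rewrite /hs /H0 mulmx_diag mxtrace_diag complex_Re_sum; apply: eq_bigr => k _.
by rewrite !mxE /= mulr0 subr0 mulrC.
Qed.

(** The squared moduli [q j i] of the entries of [P] are doubly stochastic and the trace is their
    transport cost. The potentials bound this cost below by a quantity independent of [q], and
    equality confines [q] to the pairs with [i = tau j]. *)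
Lemma hs_isospectral_ge d e (tau0 : 'I_n -> 'I_n) (alpha beta : 'I_n -> R) sigma :
    injective d -> injective tau0 -> (forall k, e k = d (tau0 k)) ->
    (forall k, alpha k + beta k = d k * e k) ->
    (forall k l, k != l -> alpha k + beta l < d k * e l) ->
    isospectral (H0 d) sigma ->
  \sum_k d k * e k <= hs sigma (H0 d) /\
  (hs sigma (H0 d) = \sum_k d k * e k -> sigma = H0 e).
Proof.
move=> d_inj tau0_inj eE ab_eq ab_lt /(isospectral_unitary d_inj)[P [tau' [Pu tau'_inj sE]]].
(* Rewrites the spectrum in terms of [e]: [d (tau' k) = e (tau k)]. *)
pose tau k := invF tau0_inj (tau' k).
have tau_inj : injective tau.
  by move=> i j /(can_inj (f_invF tau0_inj))/tau'_inj.
have {}sE : sigma = P ^t* *m H0 (e \o tau) *m P.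
  rewrite sE; congr (_ *m _ *m _); congr diag_mx; apply/rowP => k.
  by rewrite !mxE /= eE /tau f_invF.
pose q j i : R := complex.Re (P j i) ^+ 2 + complex.Im (P j i) ^+ 2.
have qE j i : (q j i)%:C%C = (P j i)^* * P j i by rewrite mulrC -normCK add_Re2_Im2.
have q_ge0 j i : 0 <= q j i by rewrite addr_ge0 ?sqr_ge0.
have row1 j : \sum_i q j i = 1.
  apply: (@complexI R); rewrite rmorph_sum rmorph1 /=.
  have /unitarymxP/matrixP/(_ j j) := Pu; rewrite !mxE eqxx => h; rewrite -[RHS]/(true%:R) -h.
  by apply: eq_bigr => i _; rewrite qE !mxE mulrC.
have PtP : P ^t* *m P = 1%:M by apply/mulmx1C/unitarymxP.
have col1 i : \sum_j q j i = 1.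
  apply: (@complexI R); rewrite rmorph_sum rmorph1 /=.
  have /matrixP/(_ i i) := PtP; rewrite !mxE eqxx => h; rewrite -[RHS]/(true%:R) -h.
  by apply: eq_bigr => j _; rewrite qE !mxE.
have sigmaE i k : sigma i k = \sum_j (P j i)^* * (e (tau j))%:C%C * P j k.
  by rewrite sE /H0 mul_mx_diag mxE; apply: eq_bigr => j _; rewrite !mxE.
have hsE : hs sigma (H0 d) = \sum_i \sum_j d i * e (tau j) * q j i.
  rewrite /hs /H0 mul_mx_diag complex_Re_sum; apply: eq_bigr => i _.
  rewrite !mxE sigmaE mulr_suml complex_Re_sum; apply: eq_bigr => j _.
  have -> : (P j i)^* * (e (tau j))%:C%C * P j i * (d i)%:C%C =
      (d i * e (tau j) * q j i)%:C%C by rewrite !rmorphM /= qE; ring.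
  by [].
(* Unit row and column sums reduce the right side to [\sum_k (alpha k + beta k)], whatever [q]
   is. *)
have potE : \sum_k d k * e k = \sum_i \sum_j (alpha i + beta (tau j)) * q j i.
  under [RHS]eq_bigr do (under eq_bigr do rewrite mulrDl;
    rewrite big_split /= -mulr_sumr col1 mulr1).
  rewrite big_split /= exchange_big /=.
  under [X in _ = _ + X]eq_bigr do rewrite -mulr_sumr row1 mulr1.
  have -> : \sum_j beta (tau j) = \sum_k beta k.
    by rewrite [RHS](reindex tau) //; exact/onW_bij/injF_bij.
  by rewrite -big_split /=; apply: eq_bigr => k _; rewrite ab_eq.
have le_ij i j : (alpha i + beta (tau j)) * q j i <= d i * e (tau j) * q j i.
  apply: ler_wpM2r => //; have [->|ne] := eqVneq i (tau j); first by rewrite ab_eq.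
  exact/ltW/ab_lt.
split; first by rewrite hsE potE; apply: ler_sum => i _; apply: ler_sum => j _.
rewrite hsE potE => eq_s.
(* Equality kills every nonnegative slack; away from [i = tau j] the potential inequality is strict,
   so the mass [q j i] itself is zero. *)
have P0 i j : i != tau j -> P j i = 0.
  move=> ne; have q0 : q j i = 0.
    have /eqP := eq_s; rewrite -subr_eq0 -sumrB psumr_eq0 => [/allP/(_ i)|k _]; last first.
      by rewrite subr_ge0 ler_sum.
    rewrite mem_index_enum => /(_ isT) /=; rewrite -sumrB psumr_eq0 => [/allP/(_ j)|k _];
      last first.
      by rewrite subr_ge0.
    rewrite mem_index_enum => /(_ isT) /=; rewrite -mulrBl mulf_eq0 => /orP[|/eqP//].
    by rewrite subr_eq0 gt_eqF ?ab_lt.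
  apply/eqP; apply: contraT => /complex_sqr_gt0.
  by rewrite -/(q j i) q0 ltxx.
apply/matrixP => i k; rewrite sigmaE H0_entry.
(* In the surviving terms [e (tau j)] equals [e i] and factors out, leaving an entry of the identity
   by unitarity. *)
have -> : (e i)%:C%C *+ (i == k) = (e i)%:C%C * (P ^t* *m P) i k.
  by rewrite PtP mxE mulr_natr.
rewrite mxE mulr_sumr; apply: eq_bigr => j _; rewrite !mxE mulrCA mulrA.
have [->|/P0->] := eqVneq i (tau j); first by [].
by rewrite conjC0 !mul0r.
Qed.

End GlobalMaximum.

(** * Stationary states *)

Section StationaryStates.
Variables (R : realType) (n : nat).
Implicit Types (a d r e : 'I_n -> R) (tau : 'I_n -> 'I_n).

(** Equal energies would make the frequencies of [(k, l)] and [(l, k)] both zero, which the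
    nonresonance condition excludes. *)
Lemma ideal_inj a (H1 : 'M[R[i]]_n) : ideal a H1 -> injective a.
Proof.
case=> omega_inj _ k l akl; apply/eqP/negPn/negP => kl.
have lk : l != k by rewrite eq_sym.
have [] : (k, l) = (l, k) by apply: omega_inj => //; rewrite /omega akl.
by move/eqP; rewrite (negbTE kl).
Qed.

(** Since the feedback vanishes, a stationary [rho] commutes with [H0 a] and is diagonal; its
    spectrum then makes it a permutation of [d]. *)
Lemma stationary_stateP a H1 d rho : ideal a H1 -> injective d -> density (H0 d) ->
  stationary_state a H1 (H0 d) rho <->
  exists2 tau, injective tau & rho = H0 (d \o tau).
Proof.
move=> H_ideal d_inj dd; split=> [st|[tau tau_inj ->]].
  have c0 := stationary_feedback0 st; have [[[[rho_herm _] _] cp] _] := st.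
  have rhoE := commuting_diag (ideal_inj H_ideal) rho_herm c0.
  move: cp; rewrite rhoE !char_poly_H0 => /prod_XsubC_reindex[|tau tau_inj tauE].
    by move=> k l /complexI/d_inj.
  exists tau => //; congr diag_mx; apply/rowP => k.
  by rewrite mxE [RHS]mxE tauE.
split; first exact: isospectral_H0.
rewrite /vfield; have -> : feedback H1 (H0 d) (H0 (d \o tau)) = 0.
  by rewrite /feedback /hs trace_commutator commutator_diag_diag mulmx0 raddf0.
by rewrite scale0r addr0 commutator_diag_diag scaler0.
Qed.

Lemma stationary_states_enum a H1 d : ideal a H1 -> injective d -> density (H0 d) ->
  exists2 rhos : (n`!).-tuple 'M[R[i]]_n, uniq rhos &
    forall rho, rho \in rhos <-> stationary_state a H1 (H0 d) rho.
Proof.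
move=> H_ideal d_inj dd.
pose s := [seq H0 (d \o (t : {perm 'I_n})) | t <- enum {perm 'I_n}].
have size_s : size s == n`!.
  by rewrite size_map -cardE -card_Sn; apply/eqP/eq_card => t; rewrite !inE.
exists (Tuple size_s) => [|rho].
  rewrite map_inj_uniq ?enum_uniq // => t t' /H0_inj tt'.
  by apply/permP => k; apply: d_inj; exact: tt'.
rewrite stationary_stateP //; split=> [/mapP[t _ ->]|[tau tau_inj ->]].
  by exists t => //; exact: perm_inj.
apply/mapP; exists (perm tau_inj); first by rewrite mem_enum.
by congr diag_mx; apply/rowP => k; rewrite mxE [RHS]mxE /= permE.
Qed.

(** Without an inversion [r] and [d] order the indices alike, and a rearrangement with the same
    order is the identical function. *)
Lemma comonotone_or_inversion d r tau : injective d -> injective tau ->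
    (forall k, r k = d (tau k)) ->
  (exists k l, (r l - r k) * (d l - d k) < 0) \/ r =1 d.
Proof.
move=> d_inj tau_inj rE.
have r_inj : injective r by move=> k l; rewrite !rE => /d_inj/tau_inj.
have [/existsP[k /existsP[l kl]]|/existsPn noinv] :=
  boolP [exists k, exists l, (r l - r k) * (d l - d k) < 0].
  by left; exists k, l.
right=> i; symmetry; apply: (eq_comonotone tau_inj rE) => k l.
have := noinv k; rewrite negb_exists => /forallP/(_ l); rewrite -leNgt => h.
have [-> |kl] := eqVneq k l; first by rewrite !ltxx.
have rkl : r k != r l by rewrite (inj_eq r_inj).
have dkl : d k != d l by rewrite (inj_eq d_inj).
by case: (ltgtP (r k) (r l)) rkl => //; case: (ltgtP (d k) (d l)) dkl => // ? _ ? _; nra.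
Qed.

End StationaryStates.

(** * Classification of the stationary states *)

Theorem theoremV2 (R : realType) (n : nat) (n_ge2 : (2 <= n)%N)
    (a : 'I_n -> R) (a_noninc : nonincreasing_energies a)
    (H1 : 'M[R[i]]_n) (H1_herm : H1 \is hermsymmx) (H_ideal : ideal a H1)
    (rhod : 'M[R[i]]_n) (rhod_density : density rhod)
    (rhod_generic : generic rhod)
    (rhod_stationary : commutator (H0 a) rhod = 0)
    (xi : 'I_(n ^ 2).-1.+1 -> 'M[R[i]]_n) (xi_basis : bloch_basis xi) :
  [/\ exists2 rhos : (n`!).-tuple 'M[R[i]]_n, uniq rhos &
        forall rho, rho \in rhos <-> stationary_state a H1 rhod rho,
      forall rho, stationary_state a H1 rhod rho ->
        hyperbolic xi a H1 rhod rho,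
      forall rho, stationary_state a H1 rhod rho ->
        (sink xi a H1 rhod rho <-> rho = rhod) &
      exists rho_max,
        [/\ stationary_state a H1 rhod rho_max,
            forall rho, lyapunov_global_max rhod rho <-> rho = rho_max,
            source xi a H1 rhod rho_max &
            forall rho, stationary_state a H1 rhod rho ->
              rho <> rhod -> rho <> rho_max -> saddle xi a H1 rhod rho]].
Proof.
have n_gt0 : (0 < n)%N by exact: leq_trans n_ge2.
have rhod_herm : rhod \is hermsymmx by case: rhod_density => -[].
have rhodE := commuting_diag (ideal_inj H_ideal) rhod_herm rhod_stationary.
move: (fun k => _) rhodE => d rhodE; subst rhod.
have d_inj := generic_H0 rhod_generic.
have stP rho := stationary_stateP rho H_ideal d_inj rhod_density.
have iso (tau : 'I_n -> 'I_n) : injective tau -> isospectral (H0 d) (H0 (d \o tau)).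
  by move=> tau_inj; exact: isospectral_H0.
have dens (tau : 'I_n -> 'I_n) : injective tau -> density (H0 (d \o tau)) by move=> tau_inj;
  have [] := iso _ tau_inj.
have dtau_inj (tau : 'I_n -> 'I_n) : injective tau -> injective (d \o tau).
  by move=> tau_inj; exact: inj_comp.
have H0_ext (r s : 'I_n -> R) : r =1 s -> H0 r = H0 s :> 'M[R[i]]_n.
  by move=> rs; congr diag_mx; apply/rowP => k; rewrite !mxE rs.
(* A stationary state other than the target has an inversion relative to [d], hence a positive
   weight. *)
have unstable (tau : 'I_n -> 'I_n) : injective tau -> H0 (d \o tau) <> H0 d ->
    exists2 z, T_eigenvalue xi a H1 (H0 d) (H0 (d \o tau)) z & 0 < complex.Re z.
  move=> tau_inj ne; have [[k [l kl]]|/H0_ext//] :=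
    @comonotone_or_inversion _ _ d (d \o tau) tau d_inj tau_inj (fun=> erefl).
  by apply: exists_unstable_diag kl => //; [exact: dens | exact: dtau_inj].
split.
- exact: stationary_states_enum.
- move=> rho /stP[tau tau_inj ->].
  by apply: hyperbolic_diag => //; [exact: dens | exact: dtau_inj].
- move=> rho /stP[tau tau_inj ->]; split=> [snk|->]; last first.
    apply: sink_diag => // k l kl.
    by rewrite -expr2 exprn_even_gt0 //= subr_eq0 (inj_eq d_inj) eq_sym.
  apply: contrapT => /unstable[//|z /snk z0 z1].
  by move: (lt_trans z0 z1); rewrite ltxx.
(* The antitone rearrangement [e] supplies the maximum [H0 e]; its order is opposite to that of [d],
   so all its weights are positive. *)
have [e [tau0 [alpha [beta [eE e_anti ab_eq ab_lt]]]]] := antitone_rearrangement d_inj.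
have tau0_inj : injective tau0 by exact: perm_inj.
have eH : H0 e = H0 (d \o tau0) :> 'M[R[i]]_n by exact: H0_ext.
have e_inj : injective e by move=> k l; rewrite !eE => /d_inj/tau0_inj.
have isoe : isospectral (H0 d) (H0 e) by rewrite eH; exact: iso.
have hs_ge sigma := hs_isospectral_ge d_inj tau0_inj eE ab_eq ab_lt (sigma := sigma).
exists (H0 e); split.
- by apply/stP; exists tau0.
- move=> rho; split=> [[rho_iso rho_max]|->].
    have [ge_s eq_s] := hs_ge rho rho_iso; apply/eq_s/eqP; rewrite eq_le ge_s andbT.
    have := rho_max _ isoe; rewrite !lyapunov_isospectral // hs_H0.
    by rewrite lerD2l lerN2.
  split=> // sigma si; rewrite !lyapunov_isospectral // hs_H0 lerD2l lerN2.
  by have [] := hs_ge sigma si.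
- apply: source_diag => //; first by case: isoe.
  move=> k l kl; have dkl : d k != d l by rewrite (inj_eq d_inj).
  by case: (ltgtP (d k) (d l)) dkl => // dlt _; have := e_anti _ _ dlt; nra.
move=> rho /stP[tau tau_inj ->] ne_d ne_e; split; last exact: unstable.
(* For a stable eigenvalue the state is compared with [e] instead of [d]: an inversion relative to
   [e] is an agreement with [d], hence a negative weight. *)
pose tau1 := invF tau0_inj \o tau.
have tau1_inj : injective tau1.
  by apply: inj_comp tau_inj; exact: can_inj (f_invF tau0_inj).
have rE k : (d \o tau) k = e (tau1 k) by rewrite eE f_invF.
have [[k [l kl]]|/H0_ext//] := comonotone_or_inversion e_inj tau1_inj rE.
have := exists_stable_diag n_gt0 xi_basis H1_herm H_ideal rhod_density (dens _ tau_inj)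
  d_inj (dtau_inj _ tau_inj) (k := k) (l := l); apply.
have kl' : k != l by apply: contraTneq kl => ->; rewrite !subrr mulr0 ltxx.
have dkl : d k != d l by rewrite (inj_eq d_inj).
by case: (ltgtP (d k) (d l)) dkl => // dlt _; have := e_anti _ _ dlt; move: kl; nra.
Qed.
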